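(* Let $(\mathcal{X}=\{X_0,\ldots,X_m\},\mathfrak{C})$ and $(\mathcal{Y}=\{Y_0,\ldots,Y_m\},\mathfrak{C})$ be two real analytic control-affine systems on $\mathbb{R}^n$ which satisfy the Assumption stated in the context (so $\mathfrak{C}=[-1,1]^m$). Let $x_0\in\mathbb{R}^n$ be an equilibrium point of $\mathcal{X}$ and suppose there exists $N\in\mathbb{N}$ such that (a) $(\mathcal{X},\mathfrak{C})$ satisfies the growth rate condition of order $N$ at $x_0$, with constants $C,T>0$, i.e. $\overline{\mathrm{B}}(x_0,Ct^N)\subseteq\mathrm{R}_{\mathcal{X}}(\le t,x_0)$ for all $t\in(0,T]$; (b) for every $i\in\{0,\ldots,m\}$, the vector fields $X_i$ and $Y_i$ have the same Taylor polynomial of order $N$ around $x_0$. For every $t\in(0,T]$, let $F^t_{\mathcal{X},\mathcal{Y}}:\overline{\mathrm{B}}(x_0,\tfrac{C}{2}t^N)\rightrightarrows\mathrm{R}_{\mathcal{Y}}(\le t,x_0)$ be the multi-valued perturbation mapping constructed (from any choices made as described) in the context. Then: (i) For every $t\in(0,T]$ and every $x\in\overline{\mathrm{B}}(x_0,\tfrac{C}{2}t^N)$, there exist $l\in\mathbb{N}$, a neighborhood $W$ of $x$ in $\overline{\mathrm{B}}(x_0,\tfrac{C}{2}t^N)$, and continuous functions $f^1,\ldots,f^l:W\to\mathbb{R}^n$ such that $$\{f^1(y)\}\subseteq F^t_{\mathcal{X},\mathcal{Y}}(y)\subseteq\{f^1(y),f^2(y),\ldots,f^l(y)\},\qquad\forall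 y\in W.$$ (ii) There exist $\alpha>0$ and $T_{\min}\in(0,T)$ such that, for every $t\in(0,T_{\min}]$ and every $x\in\overline{\mathrm{B}}(x_0,\tfrac{C}{2}t^N)$, $$\|y-x\|\le\alpha t^{N+1},\qquad\forall y\in F^t_{\mathcal{X},\mathcal{Y}}(x).$$
   Context: A real analytic control-affine system on $\mathbb{R}^n$ is a pair $(\mathcal{X},\mathfrak{C})$, where $\mathcal{X}=\{X_0,X_1,\ldots,X_m\}$ is an ordered family of real analytic vector fields on $\mathbb{R}^n$ and $\mathfrak{C}\subseteq\mathbb{R}^m$ is a set with $0\in\mathfrak{C}$. A trajectory is an absolutely continuous curve $x:[0,T]\to\mathbb{R}^n$ such that $\dot x(t)=X_0(x(t))+\sum_{i=1}^m u_i(t)X_i(x(t))$ for almost every $t\in[0,T]$, for some measurable control $u=(u_1,\ldots,u_m):[0,T]\to\mathfrak{C}$. The reachable set from $x_0$ in time at most $t$ is $$\mathrm{R}_{\mathcal{X}}(\le t,x_0)=\{x(T)\mid x:[0,T]\to\mathbb{R}^n\text{ is a trajectory of }\mathcal{X},\ x(0)=x_0,\ 0\le T\le t\}.$$ $x_0$ is an equilibrium point of $\mathcal{X}$ if $X_0(x_0)=0$. $\overline{\mathrm{B}}(x_0,r)$ is the closed Euclidean ball. The growth rate condition of order $N$ at $x_0$: there exist $C,T>0$ such that $\overline{\mathrm{B}}(x_0,Ct^N)\subset\mathrm{R}_{\mathcal{X}}(\le t,x_0)$ for every $t\in(0,T]$. Two vector fields have the same Taylor polynomial of order $N$ around $x_0$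 if all their partial derivatives of order $\le N$ (including order $0$) agree at $x_0$. For $\mathbf{u}=(u_1,\ldots,u_m)\in\mathfrak{C}$ write $X_{\mathbf{u}}=X_0+\sum_{i=1}^m u_iX_i$ (similarly $Y_{\mathbf{u}}$), and let $\exp(sX_{\mathbf{u}})$ be the time-$s$ flow map of $X_{\mathbf{u}}$. For $p\ge1$, $\mathbf{I}=(\mathbf{u}^1,\ldots,\mathbf{u}^p)\in\mathfrak{C}^p$ and $\mathbf{t}\in\mathbb{R}_{>0}^p$, let $X^{\mathbf{I},\mathbf{t}}$ be the time-dependent vector field on $[0,t_1+\cdots+t_p]$ equal to $X_{\mathbf{u}^p}$ on $[0,t_p]$, to $X_{\mathbf{u}^{p-1}}$ on $(t_p,t_{p-1}+t_p]$, ..., and to $X_{\mathbf{u}^1}$ on $(t_2+\cdots+t_p,t_1+\cdots+t_p]$. Assumption on $(\mathcal{X},\mathfrak{C})$: (i) for all $p\ge 1$, $\mathbf{I}\in\mathfrak{C}^p$ and $\mathbf{t}\in\mathbb{R}_{>0}^p$, $X^{\mathbf{I},\mathbf{t}}$ is complete, i.e. for every initial point its integral curve exists for all times at which the vector field is defined; (ii) $\mathfrak{C}=[-1,1]^m$. Construction of $F^t_{\mathcal{X},\mathcal{Y}}$ for fixed $t\in(0,T]$, with $C,T$ the constants of the growth rate condition for $\mathcal{X}$. Step 1. For every $x\in\overline{\mathrm{B}}(x_0,\tfrac C2t^N)$ choose $p_x\in\mathbb{N}$, controls $\mathbf{w}^1,\ldots,\mathbf{w}^{p_x}\in[-1,1]^m$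 and $(s_1,\ldots,s_{p_x})\in\mathbb{R}_{>0}^{p_x}$ with $s_1+\cdots+s_{p_x}<t$ (all depending on $x$), and an open neighborhood $V$ of $(s_1,\ldots,s_{p_x})$ in $\mathbb{R}^{p_x}_{>0}$, on which $t_1+\cdots+t_{p_x}\le t$, such that the map $$\xi^x_{\mathcal{X}}(t_1,\ldots,t_{p_x})=\exp(t_1X_{\mathbf{w}^1})\circ\exp(t_2X_{\mathbf{w}^2})\circ\cdots\circ\exp(t_{p_x}X_{\mathbf{w}^{p_x}})(x_0)$$ satisfies $\xi^x_{\mathcal{X}}(s_1,\ldots,s_{p_x})=x$ and is $\mathrm{C}^1$ of rank $n$ on $V$. (Such choices exist: a real analytic control-affine system that is small-time locally controllable from $x_0$ has every point of $\mathrm{int}(\mathrm{R}_{\mathcal{X}}(\le t,x_0))$ normally reachable from $x_0$ in time less than $t$, which is a known result.) Step 2. Choose a submanifold $M_x\subseteq V$ containing $(s_1,\ldots,s_{p_x})$ such that $\xi^x_{\mathcal{X}}(M_x)$ is an open neighborhood of $x$ in $\mathbb{R}^n$ and $\xi^x_{\mathcal{X}}|_{M_x}$ is a $\mathrm{C}^1$-diffeomorphism onto $\xi^x_{\mathcal{X}}(M_x)$. Choose an open neighborhood $S_x$ of $(s_1,\ldots,s_{p_x})$ in $M_x$ whose closure $\overline{S}_x$ (in $\mathbb{R}^{p_x}$) is contained in $M_x$. By compactness choose $x_1,\ldots,x_r\in\overline{\mathrm{B}}(x_0,\tfrac C2t^N)$ with $\overline{\mathrm{B}}(x_0,\tfrac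 C2t^N)\subseteq\bigcup_{i=1}^r\xi^{x_i}_{\mathcal{X}}(S_{x_i})$. Step 3. Let $p=p_{x_1}+\cdots+p_{x_r}$, let $(\mathbf{u}^1,\ldots,\mathbf{u}^p)$ be the concatenation of the control tuples chosen for $x_1,\ldots,x_r$, and regard each $\mathbb{R}^{p_{x_i}}$ (hence $\overline{S}_{x_i}$) as a subset of $\mathbb{R}^p$ via the $i$-th block of coordinates, the other coordinates being $0$. For $x\in\overline{\mathrm{B}}(x_0,\tfrac C2t^N)$ define the set $$\eta^t_{\mathcal{X}}(x)=\bigcup_{i=1}^r\{(\xi^{x_i}_{\mathcal{X}}|_{M_{x_i}})^{-1}(x)\mid x\in\xi^{x_i}_{\mathcal{X}}(\overline{S}_{x_i})\}\subseteq\bigcup_{i=1}^r\overline{S}_{x_i},$$ define $\xi^t_{\mathcal{Y}}(t_1,\ldots,t_p)=\exp(t_1Y_{\mathbf{u}^1})\circ\cdots\circ\exp(t_pY_{\mathbf{u}^p})(x_0)$ for $(t_1,\ldots,t_p)\in\bigcup_{i=1}^{r}\overline{S}_{x_i}$, and set $$F^t_{\mathcal{X},\mathcal{Y}}(x)=\xi^t_{\mathcal{Y}}(\eta^t_{\mathcal{X}}(x)).$$ *)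

(* Defs.v *)
From HB Require Import structures.
From mathcomp Require Import all_boot all_order all_algebra.
From mathcomp Require Import all_classical all_reals all_analysis.

Set Implicit Arguments.
Unset Strict Implicit.
Unset Printing Implicit Defensive.

Import Order.TTheory GRing.Theory Num.Theory.
Import numFieldNormedType.Exports.

Local Open Scope classical_set_scope.
Local Open Scope ring_scope.

(* The library norm on 'rV[R]_n is the sup norm (same topology). *)
Definition enorm (R : realType) (n : nat) (v : 'rV[R]_n) : R :=
  Num.sqrt (\sum_i v ord0 i ^+ 2).

Definition eball (R : realType) (n : nat) (x : 'rV[R]_n) (r : R) :
  set 'rV[R]_n := closed_ball_ (@enorm R n) x r.

(** Real analyticity and Taylor polynomials *)

Definition power_term (R : realType) (n : nat) (c : {ffun 'I_n -> nat} -> R)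
    (v : 'rV[R]_n) (k : {ffun 'I_n -> nat}) : R :=
  c k * \prod_i v ord0 i ^+ k i.

(* Near a, f is the sum of an absolutely convergent power series in x - a over
   the multi-indices k in nat^n; given absolute convergence, the sum is the
   limit of the partial sums over the boxes {0, ..., K-1}^n. *)
Definition analytic_at (R : realType) (n : nat) (f : 'rV[R]_n -> R)
    (a : 'rV[R]_n) : Prop :=
  exists c : {ffun 'I_n -> nat} -> R, \forall x \near a,
    summable [set: {ffun 'I_n -> nat}]
      (fun k => (power_term c (x - a) k)%:E) /\
    (fun K : nat => \sum_(k : {ffun 'I_n -> 'I_K})
       power_term c (x - a) [ffun i => nat_of_ord (k i)]) @ \oo --> f x.

Definition analytic_field (R : realType) (n : nat)
    (X : 'rV[R]_n -> 'rV[R]_n) : Prop :=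
  forall (j : 'I_n) (a : 'rV[R]_n), analytic_at (fun x => X x ord0 j) a.

Fixpoint iter_partial (R : realType) (n : nat) (s : seq 'I_n)
    (f : 'rV[R]_n -> 'rV[R]_n) : 'rV[R]_n -> 'rV[R]_n :=
  if s is i :: s' then fun x => 'D_(delta_mx ord0 i) (iter_partial s' f) x
  else f.

Definition same_taylor (R : realType) (n N : nat) (x0 : 'rV[R]_n)
    (f g : 'rV[R]_n -> 'rV[R]_n) : Prop :=
  forall s : seq 'I_n, (size s <= N)%N ->
    iter_partial s f x0 = iter_partial s g x0.

(** Control-affine systems; X ord0 is the drift X_0, and X (lift ord0 i) for
    i : 'I_m are the controlled fields X_1, ..., X_m *)

Definition control_affine_system (R : realType) (n m : nat)
    (X : 'I_m.+1 -> 'rV[R]_n -> 'rV[R]_n) (U : set 'rV[R]_m) : Prop :=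
  (forall i, analytic_field (X i)) /\ U 0.

Definition ctrl_field (R : realType) (n m : nat)
    (X : 'I_m.+1 -> 'rV[R]_n -> 'rV[R]_n) (u : 'rV[R]_m) (x : 'rV[R]_n) :
    'rV[R]_n :=
  X ord0 x + \sum_(i < m) u ord0 i *: X (lift ord0 i) x.

Definition equilibrium (R : realType) (n m : nat)
    (X : 'I_m.+1 -> 'rV[R]_n -> 'rV[R]_n) (x0 : 'rV[R]_n) : Prop :=
  X ord0 x0 = 0.

Definition abs_continuous (R : realType) (n : nat) (T : R)
    (x : R -> 'rV[R]_n) : Prop :=
  forall e : R, 0 < e -> exists2 d : R, 0 < d &
    forall (k : nat) (a b : 'I_k -> R),
      (forall i, 0 <= a i /\ a i <= b i /\ b i <= T) ->
      trivIset [set: 'I_k] (fun i => `]a i, b i[%classic) ->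
      \sum_i (b i - a i) < d ->
      \sum_i enorm (x (b i) - x (a i)) < e.

Definition trajectory (R : realType) (n m : nat)
    (X : 'I_m.+1 -> 'rV[R]_n -> 'rV[R]_n) (U : set 'rV[R]_m) (T : R)
    (x : R -> 'rV[R]_n) : Prop :=
  abs_continuous T x /\
  exists u : R -> 'rV[R]_m,
    [/\ forall i, measurable_fun `[0, T]%classic (fun t => u t ord0 i),
        forall t, `[0, T]%classic t -> U (u t) &
        {ae @lebesgue_measure R, forall t : R, `[0, T]%classic t ->
          is_derive t 1 x (ctrl_field X (u t) (x t))}].

Definition reachable (R : realType) (n m : nat)
    (X : 'I_m.+1 -> 'rV[R]_n -> 'rV[R]_n) (U : set 'rV[R]_m) (t : R)
    (x0 : 'rV[R]_n) : set 'rV[R]_n :=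
  [set y | exists (T : R) (x : R -> 'rV[R]_n),
     [/\ 0 <= T <= t, trajectory X U T x, x 0 = x0 & x T = y]].

Definition growth_rate_with (R : realType) (n m : nat)
    (X : 'I_m.+1 -> 'rV[R]_n -> 'rV[R]_n) (U : set 'rV[R]_m)
    (x0 : 'rV[R]_n) (N : nat) (C T : R) : Prop :=
  forall t : R, 0 < t <= T -> eball x0 (C * t ^+ N) `<=` reachable X U t x0.

(** Integral curves, completeness and flows *)

(* E is the set of switching times of the time-dependent field V, at which g
   need not be differentiable. Differentiability is two-sided, hence required
   on the open interval only; at 0 and S it follows one-sidedly from
   continuity. *)
Definition integral_curve (R : realType) (n : nat) (E : set R)
    (V : R -> 'rV[R]_n -> 'rV[R]_n) (S : R) (g : R -> 'rV[R]_n) : Prop :=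
  {within `[0, S]%classic, continuous g} /\
  forall s : R, `]0, S[%classic s -> ~ E s -> is_derive s 1 g (V s (g s)).

(* The field X^{I,t}: the entry with index j is in force on
   ] sum_(k > j) t k, sum_(k >= j) t k ], so the last entry comes first in
   time; the default case of the pick is the time s = 0. *)
Definition switched_field (R : realType) (n m p : nat)
    (X : 'I_m.+1 -> 'rV[R]_n -> 'rV[R]_n) (I : 'I_p.+1 -> 'rV[R]_m)
    (t : 'I_p.+1 -> R) (s : R) : 'rV[R]_n -> 'rV[R]_n :=
  let j := odflt ord_max
    [pick j : 'I_p.+1 | \sum_(k < p.+1 | (j < k)%N) t k < s
                          <= \sum_(k < p.+1 | (j <= k)%N) t k] in
  ctrl_field X (I j).

Definition switching_times (R : realType) (p : nat) (t : 'I_p.+1 -> R) :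
    set R :=
  [set s | exists j : 'I_p.+1, s = \sum_(k < p.+1 | (j < k)%N) t k].

Definition complete_switching (R : realType) (n m : nat)
    (X : 'I_m.+1 -> 'rV[R]_n -> 'rV[R]_n) (U : set 'rV[R]_m) : Prop :=
  forall (p : nat) (I : 'I_p.+1 -> 'rV[R]_m) (t : 'I_p.+1 -> R),
    (forall j, U (I j)) -> (forall j, 0 < t j) ->
    forall x : 'rV[R]_n, exists g : R -> 'rV[R]_n,
      g 0 = x /\
      integral_curve (switching_times t) (switched_field X I t)
        (\sum_j t j) g.

Definition unit_cube (R : realType) (m : nat) : set 'rV[R]_m :=
  [set u | forall i, -1 <= u ord0 i <= 1].

Definition standing_assumption (R : realType) (n m : nat)
    (X : 'I_m.+1 -> 'rV[R]_n -> 'rV[R]_n) (U : set 'rV[R]_m) : Prop :=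
  complete_switching X U /\ U = @unit_cube R m.

(* exp(sV)(x) for s >= 0; meaningful when the integral curve of V from x exists
   on [0, s] and is unique. *)
Definition flow (R : realType) (n : nat) (V : 'rV[R]_n -> 'rV[R]_n) (s : R)
    (x : 'rV[R]_n) : 'rV[R]_n :=
  get [set y | exists g : R -> 'rV[R]_n,
         [/\ g 0 = x, integral_curve set0 (fun=> V) s g & g s = y]].

(* exp(t_1 X_{w^1}) o ... o exp(t_p X_{w^p}) (x0) *)
Definition flow_comp (R : realType) (n m p : nat)
    (X : 'I_m.+1 -> 'rV[R]_n -> 'rV[R]_n) (x0 : 'rV[R]_n)
    (w : 'I_p -> 'rV[R]_m) (t : 'rV[R]_p) : 'rV[R]_n :=
  foldr (fun (j : 'I_p) y => flow (ctrl_field X (w j)) (t ord0 j) y)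
    x0 (enum 'I_p).

(** C^1 maps and submanifolds *)

(* Used for A open only. *)
Definition C1_on (R : realType) (p q : nat) (A : set 'rV[R]_p)
    (f : 'rV[R]_p -> 'rV[R]_q) : Prop :=
  forall a, A a ->
    differentiable f a /\ {for a, continuous (fun b => jacobian f b)}.

(* Embedded d-dimensional C^1 submanifold of R^p: around each point some
   C^1-diffeomorphism phi : O -> O' between open sets, with inverse psi, maps
   M `&` O onto O' `&` (R^d x {0}). *)
Definition C1_submanifold (R : realType) (p d : nat) (M : set 'rV[R]_p) :
    Prop :=
  (d <= p)%N /\
  forall a, M a -> exists (O O' : set 'rV[R]_p) (phi psi : 'rV[R]_p -> 'rV[R]_p),
    [/\ open O /\ O a, open O' /\ phi @` O = O', C1_on O phi /\ C1_on O' psi,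
        forall b, O b -> psi (phi b) = b &
        phi @` (M `&` O) =
          O' `&` [set v | forall j : 'I_p, (d <= j)%N -> v ord0 j = 0]].

(* For f of class C^1 near the submanifold M: f|_M is a C^1-diffeomorphism onto
   the open set f(M). A map into an embedded submanifold of R^p is C^1 iff it
   is C^1 as a map into R^p. *)
Definition C1_diffeo_onto_open (R : realType) (p q : nat) (M : set 'rV[R]_p)
    (f : 'rV[R]_p -> 'rV[R]_q) : Prop :=
  open (f @` M) /\
  exists g : 'rV[R]_q -> 'rV[R]_p,
    C1_on (f @` M) g /\ forall a, M a -> g (f a) = a.

(** The multi-valued perturbation mapping *)

(* The choices made for one point x: p_x, (w^1, ..., w^{p_x}),
   (s_1, ..., s_{p_x}), V, M_x, S_x. *)
Record local_choice (R : realType) (m : nat) := LocalChoice {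
  lc_p : nat;
  lc_w : 'I_lc_p -> 'rV[R]_m;
  lc_s : 'rV[R]_lc_p;
  lc_V : set 'rV[R]_lc_p;
  lc_M : set 'rV[R]_lc_p;
  lc_S : set 'rV[R]_lc_p }.
Arguments lc_w {R m} l _.
Arguments lc_V {R m} l _.
Arguments lc_M {R m} l _.
Arguments lc_S {R m} l _.

Definition lc_xi (R : realType) (n m : nat)
    (X : 'I_m.+1 -> 'rV[R]_n -> 'rV[R]_n) (x0 : 'rV[R]_n)
    (c : local_choice R m) : 'rV[R]_(lc_p c) -> 'rV[R]_n :=
  flow_comp X x0 (lc_w c).
Arguments lc_xi {R n m} X x0 c _.

Definition admissible_step1 (R : realType) (n m : nat)
    (X : 'I_m.+1 -> 'rV[R]_n -> 'rV[R]_n) (U : set 'rV[R]_m)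
    (x0 : 'rV[R]_n) (t : R) (x : 'rV[R]_n) (c : local_choice R m) : Prop :=
  [/\ (forall j, U (lc_w c j)),
      (forall j, 0 < lc_s c ord0 j) /\ \sum_j lc_s c ord0 j < t,
      open (lc_V c) /\ lc_V c (lc_s c),
      (forall v, lc_V c v ->
         (forall j, 0 < v ord0 j) /\ \sum_j v ord0 j <= t) &
      [/\ lc_xi X x0 c (lc_s c) = x,
          C1_on (lc_V c) (lc_xi X x0 c) &
          forall v, lc_V c v -> \rank (jacobian (lc_xi X x0 c) v) = n]].

(* The dimension n of M_x is forced, M_x being diffeomorphic to a nonempty open
   subset of R^n. *)
Definition admissible_step2 (R : realType) (n m : nat)
    (X : 'I_m.+1 -> 'rV[R]_n -> 'rV[R]_n) (x0 : 'rV[R]_n)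
    (c : local_choice R m) : Prop :=
  [/\ C1_submanifold n (lc_M c) /\ lc_M c `<=` lc_V c,
      lc_M c (lc_s c),
      C1_diffeo_onto_open (lc_M c) (lc_xi X x0 c),
      (exists2 O : set 'rV[R]_(lc_p c), open O & lc_S c = O `&` lc_M c) /\
        lc_S c (lc_s c) &
      closure (lc_S c) `<=` lc_M c].

Record perturbation_choice (R : realType) (n m : nat) := PerturbationChoice {
  pc_local : 'rV[R]_n -> local_choice R m;
  pc_r : nat;
  pc_x : 'I_pc_r -> 'rV[R]_n }.
Arguments pc_x {R n m} p _.

Definition pc_at (R : realType) (n m : nat) (c : perturbation_choice R n m)
    (i : 'I_(pc_r c)) : local_choice R m :=
  pc_local c (pc_x c i).
Arguments pc_at {R n m} c i.

Definition admissible (R : realType) (n m : nat)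
    (X : 'I_m.+1 -> 'rV[R]_n -> 'rV[R]_n) (U : set 'rV[R]_m)
    (x0 : 'rV[R]_n) (N : nat) (C t : R) (c : perturbation_choice R n m) :
    Prop :=
  let B := eball x0 (C / 2 * t ^+ N) in
  [/\ (forall x, B x -> admissible_step1 X U x0 t x (pc_local c x) /\
                        admissible_step2 X x0 (pc_local c x)),
      (forall i, B (pc_x c i)) &
      B `<=` \bigcup_(i : 'I_(pc_r c))
               (lc_xi X x0 (pc_at c i) @` lc_S (pc_at c i))].

Definition pc_p (R : realType) (n m : nat) (c : perturbation_choice R n m)
    (i : 'I_(pc_r c)) : nat :=
  lc_p (pc_at c i).
Arguments pc_p {R n m} c i.

(* The concatenation of the control tuples chosen for x_1, ..., x_r. *)
Definition pc_u (R : realType) (n m : nat) (c : perturbation_choice R n m)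
    (k : 'I_(\sum_i pc_p c i)%N) : 'rV[R]_m :=
  lc_w (pc_at c (tagnat.sig1 k)) (tagnat.sig2 k).
Arguments pc_u {R n m} c k.

(* The inclusion of R^{p_{x_i}} as the i-th block of coordinates of R^p: the
   l-th coordinate goes to position tagnat.Rank i l, all others are 0. *)
Definition block_embed (R : realType) (n m : nat)
    (c : perturbation_choice R n m) (i : 'I_(pc_r c))
    (v : 'rV[R]_(pc_p c i)) : 'rV[R]_(\sum_i pc_p c i)%N :=
  \row_k \sum_(l < pc_p c i | tagnat.Rank i l == k) v ord0 l.
Arguments block_embed {R n m} c i v.

Definition pc_eta (R : realType) (n m : nat)
    (X : 'I_m.+1 -> 'rV[R]_n -> 'rV[R]_n) (x0 : 'rV[R]_n)
    (c : perturbation_choice R n m) (x : 'rV[R]_n) :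
    set 'rV[R]_(\sum_i pc_p c i)%N :=
  [set v | exists i : 'I_(pc_r c),
     (lc_xi X x0 (pc_at c i) @` closure (lc_S (pc_at c i))) x /\
     exists tau : 'rV[R]_(lc_p (pc_at c i)),
       [/\ lc_M (pc_at c i) tau, lc_xi X x0 (pc_at c i) tau = x &
           v = block_embed c i tau]].
Arguments pc_eta {R n m} X x0 c x _.

Definition perturbation_map (R : realType) (n m : nat)
    (X Y : 'I_m.+1 -> 'rV[R]_n -> 'rV[R]_n) (x0 : 'rV[R]_n)
    (c : perturbation_choice R n m) (x : 'rV[R]_n) : set 'rV[R]_n :=
  flow_comp Y x0 (pc_u c) @` pc_eta X x0 c x.
Arguments perturbation_map {R n m} X Y x0 c x _.

(* Main.v *)
(** For i in 1..r and tau in M_i, the point x = xi_X(tau) and the corresponding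
    value y = xi_Y(tau) are the end points of two curves with the same switching
    times and controls, the blocks other than the i-th being run for time 0.
    Hence the values of the perturbation mapping at x are the points
    xi_Y(g_i(x)), where g_i inverts xi_X on M_i. Continuity of g_i and of the
    flows of Y (Gronwall's inequality and completeness) gives (i), and
    concatenating the integral curves shows that the values are reachable.

    For (ii), termwise differentiation of power series shows that the
    coefficients of X and Y at x_0 agree up to degree N, so that
    |X_u(z) - Y_u(z)| <= K |z - x_0|^(N+1) near x_0. Both curves stay within
    distance O(t) of x_0, and Gronwall's inequality bounds the distance of their
    end points by O(t^(N+1)). *)

(* The constant in (ii) has to be independent of [t] and of every choice made at [t]: the number of
   segments, the controls, the switching times. Hence all bounds on the fields are uniform over the
   control cube, and the comparison of the two systems is propagated in terms of the elapsed time,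
   never of the number of segments. The estimates hold only in a fixed ball around [x0]; that the
   curves stay there for short times is itself deduced from the speed bound inside the ball, and
   this circularity is broken by a continuity argument. Flows are meaningful for nonnegative times
   only, so they are shown to be continuous at positive times. The zero coordinates of the embedding
   into R^p are therefore eliminated by an exact identity before continuity is considered. Power
   series are handled as unordered sums: linear combinations, shifts of indices and termwise
   derivatives then reduce to bounds on finite sums. *)
Require Import Defs.
From HB Require Import structures.
From mathcomp Require Import all_boot all_order all_algebra.
From mathcomp Require Import all_classical all_reals all_analysis.
From mathcomp Require Import ring lra.

Set Implicit Arguments.
Unset Strict Implicit.
Unset Printing Implicit Defensive.

Import Order.TTheory GRing.Theory Num.Theory.
Import numFieldNormedType.Exports.

Local Open Scope classical_set_scope.
Local Open Scope ring_scope.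

(** * Unordered sums *)

(* Unordered summation: convergence along the directed set of finite subsets
   of I, represented by duplicate-free sequences. *)
Definition hassum (R : realType) (I : eqType) (F : I -> R) (S : R) : Prop :=
  forall e : R, 0 < e -> exists s0 : seq I, forall s, uniq s ->
    {subset s0 <= s} -> `|\sum_(k <- s) F k - S| <= e.

Lemma sumr_sub_seq (R : realType) (I : eqType) (F : I -> R) (s0 s : seq I) :
  (forall k, 0 <= F k) -> uniq s0 -> uniq s -> {subset s0 <= s} ->
  \sum_(k <- s0) F k <= \sum_(k <- s) F k.
Proof.
move=> F0 us0 us sub.
rewrite [leRHS](bigID (mem s0)) /=.
rewrite -[\sum_(k <- s | k \in s0) _]big_filter.
have -> : \sum_(k <- [seq k <- s | k \in s0]) F k = \sum_(k <- s0) F k.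
  apply: perm_big; apply: uniq_perm => //; first exact: filter_uniq.
  move=> k; rewrite mem_filter; apply/andP/idP => [[]//|ks]; split=> //.
  exact: sub.
by rewrite lerDl sumr_ge0.
Qed.

(** The estimates on power series below all pass through this lemma: the quantity to be bounded is
    written as a single unordered sum by [hassum_linear], after which only finite sums remain. *)
Lemma hassum_bound (R : realType) (I : eqType) (F : I -> R) (S B : R) :
  hassum F S -> (forall s, uniq s -> `|\sum_(k <- s) F k| <= B) -> `|S| <= B.
Proof.
move=> hF bF; apply/ler_addgt0Pr => e e0.
have [s0 hs] := hF e e0.
have us : uniq (undup s0) by exact: undup_uniq.
have := hs _ us; move/(_ (fun k => _)) => h.
have {}h : `|\sum_(k <- undup s0) F k - S| <= e.
  by apply: h => ks; rewrite mem_undup.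
have := bF _ us.
have := ler_normB (\sum_(k <- undup s0) F k) (\sum_(k <- undup s0) F k - S).
rewrite opprB addrC subrK => h1 h2.
by apply: (le_trans h1); exact: lerD.
Qed.

Lemma hassum_linear (R : realType) (I : eqType) (F G : I -> R) (a S S' : R) :
  hassum F S -> hassum G S' -> hassum (fun k => F k + a * G k) (S + a * S').
Proof.
move=> hF hG e e0.
have e20 : 0 < e / 2 by rewrite divr_gt0.
have a0 : 0 < `|a| + 1 by rewrite ltr_wpDl.
have [s0 h0] := hF _ e20.
have [s1 h1] := hG _ (divr_gt0 e20 a0).
exists (s0 ++ s1) => s us sub.
have {}h0 : `|\sum_(k <- s) F k - S| <= e / 2.
  by apply: h0 => // k ks; apply: sub; rewrite mem_cat ks.
have {}h1 : `|\sum_(k <- s) G k - S'| <= e / 2 / (`|a| + 1).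
  by apply: h1 => // k ks; apply: sub; rewrite mem_cat ks orbT.
rewrite big_split /= -mulr_sumr.
have -> : \sum_(k <- s) F k + a * (\sum_(k <- s) G k) - (S + a * S') =
  (\sum_(k <- s) F k - S) + a * (\sum_(k <- s) G k - S') by ring.
apply: (le_trans (ler_normD _ _)).
rewrite [leRHS](splitr e); apply: lerD => //.
rewrite normrM; apply: (@le_trans _ _ ((`|a| + 1) * (e / 2 / (`|a| + 1)))).
  by apply: ler_pM => //; rewrite lerDl.
by rewrite mulrC divfK// gt_eqF.
Qed.

Lemma hassum_ext {R : realType} {I : eqType} (F G : I -> R) (S : R) :
  F =1 G -> hassum F S -> hassum G S.
Proof. by move=> /funext ->. Qed.

Lemma hassum_unique (R : realType) (I : eqType) (F : I -> R) (S S' : R) :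
  hassum F S -> hassum F S' -> S = S'.
Proof.
move=> h h'; apply/eqP; rewrite -subr_eq0 -normr_le0.
have := @hassum_linear _ _ _ _ (-1) _ _ h h'.
rewrite mulN1r => /hassum_bound; apply=> s us.
by rewrite big1 ?normr0// => k _; rewrite mulN1r subrr.
Qed.

Lemma nonneg_hassum (R : realType) (I : eqType) (F : I -> R) (B : R) :
  (forall k, 0 <= F k) ->
  (forall s, uniq s -> \sum_(k <- s) F k <= B) -> exists S, hassum F S.
Proof.
move=> F0 bF.
pose E := [set \sum_(k <- s) F k | s in [set s : seq I | uniq s]].
have supE : has_sup E.
  split; first by exists 0; exists [::]; rewrite ?big_nil.
  by exists B => _ [s us <-]; exact: bF.
exists (sup E) => e e0.
have [_ [s0 us0 <-] hs0] := sup_adherent e0 supE.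
exists s0 => s us sub.
have h1 := @sumr_sub_seq _ _ _ _ _ F0 us0 us sub.
have h2 : \sum_(k <- s) F k <= sup E.
  by apply: ub_le_sup; [exact: supE.2|exists s].
rewrite ler_norml; lra.
Qed.

(** [F] is the difference of the nonnegative families [F + |F|] and [|F|], whose sums exist as
    suprema of finite sums. *)
Lemma abs_hassum (R : realType) (I : eqType) (F : I -> R) (B : R) :
  (forall s, uniq s -> \sum_(k <- s) `|F k| <= B) -> exists S, hassum F S.
Proof.
move=> bF.
have [S hS] := @nonneg_hassum _ _ (fun k => `|F k|) B (fun k => normr_ge0 _) bF.
have [|s us|S' hS'] := @nonneg_hassum _ _ (fun k => F k + `|F k|) (B + B).
- by move=> k; have := ler_norm (- F k); rewrite normrN; lra.
- rewrite big_split /=; apply: lerD; last exact: bF.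
  by apply: le_trans (bF _ us); apply: ler_sum => k _; exact: ler_norm.
exists (S' + -1 * S).
apply: hassum_ext (@hassum_linear _ _ _ _ (-1) _ _ hS' hS) => k.
by ring.
Qed.

(** Intended for the shift of multi-indices, which is injective but misses those with [k i = 0]; the
    derivative of such a monomial in direction [i] vanishes. *)
Lemma hassum_reindex (R : realType) (I J : eqType) (f : I -> J) (g : J -> I)
    (F : J -> R) (S : R) :
  cancel f g -> (forall k, F k != 0 -> f (g k) = k) ->
  hassum (F \o f) S -> hassum F S.
Proof.
move=> fK gK hF e e0; have [s0 hs0] := hF e e0.
exists (map f s0) => s us sub.
pose s1 := [seq k <- s | f (g k) == k].
have us1 : uniq (map g s1).
  rewrite map_inj_in_uniq ?filter_uniq// => k l.
  rewrite !mem_filter => /andP[/eqP fk _] /andP[/eqP fl _] gkl.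
  by rewrite -fk gkl.
have := hs0 _ us1; rewrite big_map big_filter /=.
have -> : \sum_(k <- s | f (g k) == k) F (f (g k)) = \sum_(k <- s) F k.
  rewrite [RHS](bigID (fun k => f (g k) == k)) /= [X in _ + X]big1 ?addr0.
    by apply: eq_bigr => k /eqP ->.
  by move=> k nk; apply: contraNeq nk => /gK ->.
apply=> k ks; rewrite -[k]fK; apply: map_f; rewrite mem_filter fK eqxx /=.
by apply: sub; exact: map_f.
Qed.

(** * Power series in several variables *)

Lemma coord_norm_le (R : realType) (n : nat) (v : 'rV[R]_n) j :
  `|v ord0 j| <= `|v|.
Proof.
by rewrite [leRHS]/Num.Def.normr/= mx_normrE; exact: (le_bigmax _ _ (ord0, j)).
Qed.

Lemma norm_row_le (R : realType) (n : nat) (v : 'rV[R]_n) r :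
  0 <= r -> (forall j, `|v ord0 j| <= r) -> `|v| <= r.
Proof.
move=> r0 vr; rewrite [leLHS]/Num.Def.normr/= mx_normrE.
by apply: bigmax_le => // -[i j] _; rewrite (ord1 i).
Qed.

Definition mono (R : realType) (n : nat) (v : 'rV[R]_n)
  (k : {ffun 'I_n -> nat}) : R := \prod_i v ord0 i ^+ k i.

Definition mdeg (n : nat) (k : {ffun 'I_n -> nat}) : nat := (\sum_i k i)%N.

Lemma mono_bound (R : realType) (n : nat) (v : 'rV[R]_n) r k :
  (forall j, `|v ord0 j| <= r) -> `|mono v k| <= r ^+ mdeg k.
Proof.
move=> vr; rewrite /mono /mdeg normr_prod -prodrXr; apply: ler_prod => j _.
by rewrite normr_ge0 normrX lerXn2r ?nnegrE// (le_trans _ (vr j)).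
Qed.

(* Increments of monomials are compared with those of the monomial of the same
   degree in one variable, from rho to rho + d. This yields bounds without
   factors depending on the degree, so that they sum against the coefficients
   of a power series converging at radius rho + d. *)
Section monomial_increments.
Variables (R : realType) (rho d t : R).
Hypotheses (rho0 : 0 <= rho) (d0 : 0 <= d) (t0 : 0 <= t).

Let close (A B : R) (m : nat) := [/\ `|A| <= (rho + d) ^+ m, `|B| <= rho ^+ m &
  `|A - B| <= t * ((rho + d) ^+ m - rho ^+ m)].

Let close1 : close 1 1 0.
Proof. by split; rewrite ?expr0 ?normr1// !subrr normr0 mulr0. Qed.

(** The three bounds travel together because the product rule needs the sizes of the factors. The
    increments of the one-variable powers telescope in the same way, so the last comparison is an
    equality. *)
Let closeM A B m A' B' m' :
  close A B m -> close A' B' m' -> close (A * A') (B * B') (m + m').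
Proof.
move=> [a b ab] [a' b' ab']; split.
- by rewrite normrM exprD ler_pM.
- by rewrite normrM exprD ler_pM.
have -> : A * A' - B * B' = A * (A' - B') + (A - B) * B' by ring.
apply: (le_trans (ler_normD _ _)); rewrite !normrM !exprD.
have h1 := ler_pM (normr_ge0 _) (normr_ge0 _) a ab'.
have h2 := ler_pM (normr_ge0 _) (normr_ge0 _) ab b'.
apply: (le_trans (lerD h1 h2)).
by rewrite le_eqVlt; apply/orP; left; apply/eqP; ring.
Qed.

Lemma mono_increment (n : nat) (u v : 'rV[R]_n) k :
  (forall j, `|u ord0 j| <= rho + d) -> (forall j, `|v ord0 j| <= rho) ->
  (forall j, `|u ord0 j - v ord0 j| <= t * d) ->
  `|mono u k - mono v k| <= t * ((rho + d) ^+ mdeg k - rho ^+ mdeg k).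
Proof.
move=> hu hv huv.
suff [] : close (mono u k) (mono v k) (mdeg k) by [].
apply: (big_ind3 close) => [|A B m A' B' m'|i _];
  [exact: close1|exact: closeM|].
elim: (k i) => [|p ih]; first by rewrite !expr0; exact: close1.
rewrite !exprS -[p.+1]add1n; apply: closeM => //; split; rewrite ?expr1//.
by rewrite [X in t * X](_ : _ = d); [exact: huv|ring].
Qed.

(** As a polynomial in [y] and [h] the remainder has nonnegative coefficients and order at least 2
    in [h], so it is at most [t ^ 2] times its value [a m] at [(rho, d)]. The recursion [step] shows
    this without a binomial expansion. *)
Lemma expr_taylor1 (y h : R) m : `|y| <= rho -> `|h| <= t * d -> t <= 1 ->
  `|(y + h) ^+ m - y ^+ m - m%:R * h * y ^+ m.-1| <=
  t ^+ 2 * (rho + d) ^+ m.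
Proof.
move=> yr hd t1.
pose a p := (rho + d) ^+ p - rho ^+ p - p%:R * d * rho ^+ p.-1.
apply: (@le_trans _ _ (t ^+ 2 * a m)); last first.
  apply: ler_wpM2l; first exact: sqr_ge0.
  rewrite /a -addrA gerDl -opprD oppr_le0 addr_ge0// ?exprn_ge0//.
  by rewrite mulr_ge0 ?exprn_ge0// mulr_ge0.
have step (z k : R) p :
    (z + k) ^+ p.+1 - z ^+ p.+1 - p.+1%:R * k * z ^+ p.+1.-1 =
    (z + k) * ((z + k) ^+ p - z ^+ p - p%:R * k * z ^+ p.-1) +
    p%:R * k ^+ 2 * z ^+ p.-1.
  case: p => [|p] /=; first by rewrite !expr1 !expr0; ring.
  rewrite !exprS -(natr1 p.+1); ring.
elim: m => [|m ih]; first by rewrite /a !expr0 !mul0r !subrr normr0 mulr0.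
rewrite /a !step; apply: (le_trans (ler_normD _ _)).
rewrite [leRHS]mulrDr; apply: lerD.
  rewrite normrM mulrCA; apply: ler_pM => //.
  apply: (le_trans (ler_normD _ _)); apply: lerD => //.
  by apply: (le_trans hd); rewrite ler_piMl.
rewrite !normrM normr_nat -mulrA mulrCA -[leRHS]mulrCA mulrA.
rewrite [leRHS](_ : _ = m%:R * ((t * d) ^+ 2 * rho ^+ m.-1)); last by ring.
rewrite [leLHS](_ : _ = m%:R * (`|h| ^+ 2 * `|y| ^+ m.-1)); last first.
  by rewrite !normrX; ring.
apply: ler_wpM2l => //; apply: ler_pM; rewrite ?exprn_ge0//.
  by rewrite lerXn2r ?nnegrE// mulr_ge0.
by rewrite lerXn2r ?nnegrE// (le_trans _ yr).
Qed.

(** One term of the binomial expansion. It absorbs the degree factor created by differentiation into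
    a larger radius. *)
Lemma natr_expr_le m : m%:R * d * rho ^+ m.-1 <= (rho + d) ^+ m.
Proof.
have: 0 <= (rho + d) ^+ m - rho ^+ m - m%:R * d * rho ^+ m.-1.
  elim: m => [|m ih]; first by rewrite !expr0 !mul0r !subrr.
  have -> : (rho + d) ^+ m.+1 - rho ^+ m.+1 - m.+1%:R * d * rho ^+ m.+1.-1 =
    (rho + d) * ((rho + d) ^+ m - rho ^+ m - m%:R * d * rho ^+ m.-1) +
    m%:R * d ^+ 2 * rho ^+ m.-1.
    case: m {ih} => [|p] /=; first by rewrite !expr1 !expr0; ring.
    by rewrite !exprS -(natr1 p.+1); ring.
  by rewrite addr_ge0// !mulr_ge0 ?exprn_ge0// addr_ge0.
have : 0 <= rho ^+ m by rewrite exprn_ge0.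
lra.
Qed.

End monomial_increments.

(* The norm of row vectors is the sup norm, so this is an expansion on the
   closed polydisc of radius r around a. *)
Definition pser (R : realType) (n : nat) (a : 'rV[R]_n) (f : 'rV[R]_n -> R)
    (c : {ffun 'I_n -> nat} -> R) : Prop :=
  exists r B : R, [/\ 0 < r,
    forall s, uniq s -> \sum_(k <- s) `|c k| * r ^+ mdeg k <= B &
    forall v, `|v| <= r -> hassum (fun k => c k * mono v k) (f (a + v))].

Lemma pser_bound_shrink (R : realType) (n : nat) (c : {ffun 'I_n -> nat} -> R)
    (r r' B : R) (s : seq {ffun 'I_n -> nat}) : 0 <= r' <= r ->
  \sum_(k <- s) `|c k| * r ^+ mdeg k <= B ->
  \sum_(k <- s) `|c k| * r' ^+ mdeg k <= B.
Proof.
move=> /andP[r0 rr'] h; apply: le_trans h; apply: ler_sum => k _.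
by apply: ler_wpM2l => //; rewrite lerXn2r ?nnegrE// (le_trans r0).
Qed.

Lemma box_seq (n K : nat) : exists2 s : seq {ffun 'I_n -> nat}, uniq s &
  (forall k : {ffun 'I_n -> nat}, (forall i, (k i < K)%N) -> k \in s) /\
  forall (R : realType) (F : {ffun 'I_n -> nat} -> R),
  \sum_(k <- s) F k =
  \sum_(k : {ffun 'I_n -> 'I_K}) F [ffun i => nat_of_ord (k i)].
Proof.
pose g := fun k : {ffun 'I_n -> 'I_K} => [ffun i => nat_of_ord (k i)].
exists (map g (index_enum {ffun 'I_n -> 'I_K})).
  rewrite map_inj_uniq ?index_enum_uniq// => k l /ffunP kl.
  by apply/ffunP => i; apply/val_inj; have := kl i; rewrite !ffunE.
split=> [k kK|R F]; last by rewrite big_map.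
apply/mapP; exists [ffun i => Ordinal (kK i)]; first by rewrite mem_index_enum.
by apply/ffunP => i; rewrite !ffunE.
Qed.

(** Every finite set of multi-indices lies in a box, so the boxes are cofinal among the finite
    sets. *)
Lemma hassum_box (R : realType) (n : nat) (F : {ffun 'I_n -> nat} -> R) S l :
  hassum F S ->
  (fun K : nat => \sum_(k : {ffun 'I_n -> 'I_K})
    F [ffun i => nat_of_ord (k i)]) @ \oo --> l -> S = l.
Proof.
move=> hF cF; apply/eqP; rewrite -subr_eq0 -normr_le0.
apply/ler_addgt0Pr => e e0; rewrite add0r.
have e20 : 0 < e / 2 by rewrite divr_gt0.
have [s0 hs0] := hF _ e20.
move/cvgrPdist_le : cF => /(_ _ e20)[K0 _ hK0].
(* A crude common bound for all coordinates of all indices in [s0]. *)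
pose K1 := (\sum_(k <- s0) \sum_i k i)%N.
pose K := maxn K0 K1.+1.
have := hK0 K (leq_maxl _ _).
have [s us [sin seqs]] := box_seq n K.
rewrite -seqs => h2.
have h1 : `|\sum_(k <- s) F k - S| <= e / 2.
  apply: hs0 => // k ks; apply: sin => i.
  rewrite leq_max; apply/orP; right; rewrite ltnS /K1.
  rewrite (big_rem k)//=; apply: leq_trans (leq_addr _ _).
  by rewrite (bigD1 i)//= leq_addr.
have -> : S - l = (\sum_(k <- s) F k - l) - (\sum_(k <- s) F k - S) by ring.
apply: (le_trans (ler_normB _ _)); rewrite [leRHS](splitr e) lerD//.
by rewrite distrC.
Qed.

Lemma analytic_pser (R : realType) (n : nat) (f : 'rV[R]_n -> R) a :
  analytic_at f a -> exists c, pser a f c.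
Proof.
move=> [c /nbhs_ballP[r0 /= r00 hr]]; exists c.
pose r := r0 / 2.
have rp : 0 < r by rewrite divr_gt0.
have hv v : `|v| <= r -> summable [set: {ffun 'I_n -> nat}]
      (fun k => (power_term c v k)%:E) /\
    (fun K : nat => \sum_(k : {ffun 'I_n -> 'I_K})
       power_term c v [ffun i => nat_of_ord (k i)]) @ \oo --> f (a + v).
  move=> vr; have := hr (a + v); rewrite addrAC subrr add0r; apply.
  rewrite -ball_normE /ball_/= opprD addrA subrr add0r normrN.
  by apply: (le_lt_trans vr); rewrite /r; lra.
have summ v : `|v| <= r -> exists B, forall s, uniq s ->
    \sum_(k <- s) `|c k * mono v k| <= B.
  move=> /hv[sm _]; rewrite summableE in sm.
  exists (fine (\esum_(k in [set: {ffun 'I_n -> nat}])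
    `|(power_term c v k)%:E|))%E => s us.
  rewrite -lee_fin fineK//; apply: esum_ge; exists [set` s].
    by split; [exact: finite_seq|exact: subsetT].
  by rewrite -fsbig_seq// -sumEFin.
(* At the corner of the polydisc each monomial equals [r ^ mdeg k], its maximum over the polydisc,
   so summability at this one point yields the bound [B]. *)
have [|B hB] := summ (const_mx r).
  by apply: norm_row_le => [|j]; [exact: ltW|rewrite mxE gtr0_norm].
exists r, B; split=> // [s us|v vr].
  apply: le_trans (hB _ us); apply: ler_sum => k _.
  rewrite normrM /mono; under eq_bigr do rewrite mxE.
  by rewrite prodrXr (ger0_norm (exprn_ge0 _ (ltW rp))).
have [B' hB'] := summ v vr.
have [S hS] := abs_hassum hB'.
suff <- : S = f (a + v) by [].
exact: hassum_box hS (hv v vr).2.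
Qed.

Lemma pser_lipschitz (R : realType) (n : nat) (a : 'rV[R]_n) f c :
  pser a f c -> exists r L : R, [/\ 0 < r, 0 <= L &
    forall u v, `|u| <= r -> `|v| <= r ->
      `|f (a + u) - f (a + v)| <= L * `|u - v|].
Proof.
move=> [r [B [r0 hB hf]]].
have B0 : 0 <= B by have := hB [::] isT; rewrite big_nil.
(* The coefficients are summable at radius [rho + d = r]; increments are measured in units of [d],
   whence the Lipschitz constant [B / d]. *)
pose rho := r / 3; pose d := 2 * rho.
have rho0 : 0 < rho by rewrite divr_gt0.
have d0 : 0 < d by rewrite mulr_gt0.
have rd : rho + d = r by rewrite /d /rho; field.
exists rho, (B / d); split=> // [|u v ur vr]; first by rewrite divr_ge0// ltW.
have hu := hf u (le_trans ur _); have hv := hf v (le_trans vr _).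
have rr : rho <= r by rewrite -rd lerDl ltW.
have := @hassum_linear _ _ _ _ (-1) _ _ (hu rr) (hv rr); rewrite mulN1r.
move/hassum_bound; apply=> s us.
pose t := `|u - v| / d.
have t0 : 0 <= t by rewrite divr_ge0// ltW.
apply: (@le_trans _ _ (\sum_(k <- s) t * (`|c k| * r ^+ mdeg k))).
  apply: (le_trans (ler_norm_sum _ _ _)); apply: ler_sum => k _.
  rewrite mulN1r -mulrBr normrM mulrCA; apply: ler_wpM2l => //.
  apply: (@le_trans _ _ (t * ((rho + d) ^+ mdeg k - rho ^+ mdeg k))).
    apply: mono_increment => //; try exact: ltW.
    - move=> j; apply: (le_trans (coord_norm_le _ _)); rewrite rd.
      exact: le_trans rr.
    - by move=> j; apply: (le_trans (coord_norm_le _ _)).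
    - move=> j; rewrite /t divfK ?gt_eqF//.
      by have := coord_norm_le (u - v) j; rewrite !mxE.
  by rewrite rd; apply: ler_wpM2l => //; rewrite gerBl exprn_ge0// ltW.
rewrite -mulr_sumr [leRHS](_ : _ = t * B); last by rewrite /t; ring.
by apply: ler_wpM2l => //; exact: hB.
Qed.

(** Scaling: with [t = |v| / r <= 1], a term of degree at least [N] is at most [t ^ N] times its
    bound at radius [r]. *)
Lemma pser_flat (R : realType) (n : nat) (a : 'rV[R]_n) f c N :
  pser a f c -> (forall k, (mdeg k < N)%N -> c k = 0) ->
  exists r K : R, [/\ 0 < r, 0 <= K &
    forall v, `|v| <= r -> `|f (a + v)| <= K * `|v| ^+ N].
Proof.
move=> [r [B [r0 hB hf]]] c0.
have B0 : 0 <= B by have := hB [::] isT; rewrite big_nil.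
exists r, (B / r ^+ N); split=> // [|v vr].
  by rewrite divr_ge0// exprn_ge0// ltW.
have /hassum_bound := hf v vr; apply=> s us.
pose t := `|v| / r.
have t0 : 0 <= t by rewrite divr_ge0// ltW.
have t1 : t <= 1 by rewrite ler_pdivrMr// mul1r.
have vE : `|v| = t * r by rewrite /t divfK// gt_eqF.
apply: (@le_trans _ _ (\sum_(k <- s) t ^+ N * (`|c k| * r ^+ mdeg k))).
  apply: (le_trans (ler_norm_sum _ _ _)); apply: ler_sum => k _.
  have [kN|Nk] := ltnP (mdeg k) N.
    by rewrite c0// mul0r !normr0 mul0r mulr0.
  rewrite normrM mulrCA; apply: ler_wpM2l => //.
  apply: (le_trans (mono_bound _ (coord_norm_le v))).
  rewrite vE exprMn; apply: ler_wpM2r; first by rewrite exprn_ge0// ltW.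
  by apply: ler_wiXn2l.
rewrite -mulr_sumr [leRHS](_ : _ = t ^+ N * B).
  by apply: ler_wpM2l; [rewrite exprn_ge0|exact: hB].
by rewrite /t expr_div_n; ring.
Qed.

(** * Termwise differentiation *)

Definition mshift (n : nat) (i : 'I_n) (k : {ffun 'I_n -> nat}) :
  {ffun 'I_n -> nat} := [ffun j => (k j + (j == i))%N].

Definition munshift (n : nat) (i : 'I_n) (k : {ffun 'I_n -> nat}) :
  {ffun 'I_n -> nat} := [ffun j => (k j - (j == i))%N].

Lemma mshiftK (n : nat) (i : 'I_n) : cancel (mshift i) (munshift i).
Proof. by move=> k; apply/ffunP => j; rewrite !ffunE addnK. Qed.

Lemma munshiftK (n : nat) (i : 'I_n) (k : {ffun 'I_n -> nat}) :
  (0 < k i)%N -> mshift i (munshift i k) = k.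
Proof.
move=> ki; apply/ffunP => j; rewrite !ffunE subnK//.
by case: eqVneq => // ->.
Qed.

Lemma mdeg_mshift (n : nat) (i : 'I_n) k : mdeg (mshift i k) = (mdeg k).+1.
Proof.
rewrite /mdeg; under eq_bigr do rewrite ffunE.
rewrite big_split /= -addn1; congr addn.
by rewrite (bigD1 i)//= eqxx big1 ?addn0// => j /negPf ->.
Qed.

(** The partial derivative of [mono v k] in direction [i]. The truncated predecessor is harmless:
    for [k i = 0] the factor in front vanishes. *)
Definition dmono (R : realType) (n : nat) (i : 'I_n) (v : 'rV[R]_n)
    (k : {ffun 'I_n -> nat}) : R :=
  (k i)%:R * v ord0 i ^+ (k i).-1 * \prod_(j | j != i) v ord0 j ^+ k j.

Lemma dmono_mshift (R : realType) (n : nat) (i : 'I_n) (v : 'rV[R]_n)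
    (k : {ffun 'I_n -> nat}) :
  dmono i v (mshift i k) = (k i).+1%:R * mono v k.
Proof.
rewrite /dmono /mono ffunE eqxx addn1 /= -mulrA; congr (_ * _).
rewrite [RHS](bigD1 i)//=; congr (_ * _); apply: eq_bigr => j /negPf ji.
by rewrite ffunE ji addn0.
Qed.

(** Only coordinate [i] moves, so the remainder is a one-variable remainder times a fixed product of
    the other coordinates. *)
Lemma mono_taylor1 (R : realType) (n : nat) (i : 'I_n) (v : 'rV[R]_n)
    (h rho d : R) (k : {ffun 'I_n -> nat}) :
  0 <= rho -> 0 < d -> `|v| <= rho -> `|h| <= d ->
  `|mono (v + h *: delta_mx ord0 i) k - mono v k - h * dmono i v k| <=
  (h / d) ^+ 2 * (rho + d) ^+ mdeg k.
Proof.
move=> rho0 d0 vr hd.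
pose P := \prod_(j | j != i) v ord0 j ^+ k j.
have -> : mono (v + h *: delta_mx ord0 i) k = (v ord0 i + h) ^+ k i * P.
  rewrite /mono (bigD1 i)//= !mxE !eqxx mulr1; congr (_ * _).
  by apply: eq_bigr => j /negPf ji; rewrite !mxE ji andbF mulr0 addr0.
have -> : mono v k = v ord0 i ^+ k i * P by rewrite /mono (bigD1 i).
rewrite /dmono -/P.
have -> : (v ord0 i + h) ^+ k i * P - v ord0 i ^+ k i * P -
   h * ((k i)%:R * v ord0 i ^+ (k i).-1 * P) =
   ((v ord0 i + h) ^+ k i - v ord0 i ^+ k i -
     (k i)%:R * h * v ord0 i ^+ (k i).-1) * P by ring.
rewrite normrM /mdeg (bigD1 i)//= exprD mulrA.
apply: ler_pM => //; last first.
  rewrite /P normr_prod -prodrXr; apply: ler_prod => j _.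
  rewrite normr_ge0 normrX lerXn2r ?nnegrE ?addr_ge0 ?(ltW d0)//.
  apply: (le_trans (coord_norm_le _ _)); apply: (le_trans vr).
  by rewrite lerDl ltW.
have -> : (h / d) ^+ 2 = (`|h| / d) ^+ 2.
  by rewrite !expr_div_n real_normK ?num_real.
apply: expr_taylor1 => //.
- exact: ltW.
- by rewrite divr_ge0// ltW.
- exact: le_trans (coord_norm_le _ _) vr.
- by rewrite divfK// gt_eqF.
- by rewrite ler_pdivrMr// mul1r.
Qed.

Lemma is_derive_quadratic (R : realType) (V : normedModType R) (f : V -> R)
    (x v : V) (l K d : R) : 0 < d -> 0 <= K ->
  (forall h, `|h| <= d -> `|f (x + h *: v) - f x - h * l| <= K * h ^+ 2) ->
  is_derive x v f l.
Proof.
move=> d0 K0 hf.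
have H : (fun h => h^-1 *: ((f \o shift x) (h *: v) - f x)) @ 0^' --> l.
  apply/cvgrPdist_le => e e0; near=> h.
  have h0 : h != 0 by near: h; exact: nbhs_dnbhs_neq.
  have hd : `|h| <= d by near: h; apply: dnbhs0_le.
  have he : `|h| <= e / (K + 1).
    by near: h; apply: dnbhs0_le; rewrite divr_gt0// ltr_wpDl.
  rewrite /= [_ + x]addrC.
  have -> : l - h^-1 *: (f (x + h *: v) - f x) =
      - (h^-1 * (f (x + h *: v) - f x - h * l)).
    by rewrite mulrBr mulrA mulVf// mul1r opprB.
  rewrite normrN normrM normfV ler_pdivrMl ?normr_gt0//.
  apply: (le_trans (hf _ hd)).
  rewrite -[h ^+ 2]real_normK ?num_real// expr2 mulrA mulrC.
  apply: ler_wpM2l => //.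
  apply: (@le_trans _ _ ((K + 1) * (e / (K + 1)))); last first.
    by rewrite mulrC divfK// gt_eqF// ltr_wpDl.
  by apply: ler_pM => //; rewrite lerDl.
apply: DeriveDef; first by apply/cvg_ex; exists l.
by apply/cvg_lim => //; exact: H.
Unshelve. all: by end_near. Qed.

(** Summed against the coefficients, the Taylor remainders of the monomials stay below
    [(h / rho) ^ 2 * B]. This quadratic bound identifies the directional derivative with the sum of
    the differentiated series. *)
Lemma pser_derive (R : realType) (n : nat) (a : 'rV[R]_n) f c i :
  pser a f c ->
  pser a ('D_(delta_mx ord0 i) f) 
    (fun k : {ffun 'I_n -> nat} => (k i).+1%:R * c (mshift i k)) /\
  \forall x \near a, derivable f x (delta_mx ord0 i).
Proof.
move=> [r [B [r0 hB hf]]].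
have B0 : 0 <= B by have := hB [::] isT; rewrite big_nil.
(* Half of the radius is given up: it pays for the degree factor in the new coefficients and for the
   increment [h]. *)
pose rho := r / 2.
pose c' (k : {ffun 'I_n -> nat}) := (k i).+1%:R * c (mshift i k).
have rho0 : 0 < rho by rewrite divr_gt0.
have rd : rho + rho = r by rewrite /rho; field.
clearbody rho.
have hB' s : uniq s -> \sum_(k <- s) `|c' k| * rho ^+ mdeg k <= B / rho.
  move=> us.
  have us' : uniq (map (mshift i) s).
    by rewrite map_inj_uniq//; exact: can_inj (@mshiftK _ i).
  rewrite ler_pdivlMr//; apply: le_trans (hB _ us').
  rewrite big_map mulr_suml; apply: ler_sum => k _.
  rewrite /c' normrM normr_nat mulrAC mulrC -!mulrA.
  rewrite [leLHS](_ : _ = `|c (mshift i k)| *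
     ((k i).+1%:R * rho * rho ^+ mdeg k)); last by ring.
  apply: ler_wpM2l => //; rewrite mdeg_mshift -rd.
  apply: le_trans (natr_expr_le (ltW rho0) (ltW rho0) (mdeg k).+1).
  rewrite -!mulrA /=.
  apply: (ler_wpM2r (mulr_ge0 (ltW rho0) (exprn_ge0 _ (ltW rho0)))).
  by rewrite ler_nat ltnS /mdeg (bigD1 i)//= leq_addr.
have hs v : `|v| <= rho -> exists S, hassum (fun k => c' k * mono v k) S.
  move=> vr; apply: (@abs_hassum _ _ _ (B / rho)) => s us.
  apply: le_trans (hB' _ us); apply: ler_sum => k _.
  rewrite normrM; apply: ler_wpM2l => //; apply: mono_bound => j.
  exact: le_trans (coord_norm_le _ _) vr.
have hd v S : `|v| <= rho -> hassum (fun k => c' k * mono v k) S ->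
    is_derive (a + v) (delta_mx ord0 i) f S.
  move=> vr hS.
  have {}hS : hassum (fun k => c k * dmono i v k) S.
    apply: (@hassum_reindex _ _ _ _ _ _ _ (@mshiftK _ i)) => [k|].
      rewrite mulf_eq0 negb_or => /andP[_ kv]; apply: munshiftK.
      by rewrite lt0n; apply: contraNneq kv => k0; rewrite /dmono k0 !mul0r.
    by apply: hassum_ext hS => k; rewrite /= dmono_mshift /c'; ring.
  apply: (@is_derive_quadratic _ _ _ _ _ _ (B / rho ^+ 2) rho) => // [|h hr].
    by rewrite divr_ge0// sqr_ge0.
  have vr' : `|v| <= r by apply: (le_trans vr); rewrite -rd lerDl ltW.
  have vhr : `|v + h *: delta_mx ord0 i| <= r.
    apply: norm_row_le => [|j]; first exact: ltW.
    rewrite !mxE; apply: (le_trans (ler_normD _ _)); rewrite -rd lerD//.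
      exact: le_trans (coord_norm_le _ _) vr.
    rewrite normrM; apply: le_trans hr; rewrite ler_piMr//.
    by case: (_ && _); rewrite ?normr1 ?normr0.
  rewrite -[a + v + _]addrA.
  have h1 := @hassum_linear _ _ _ _ (-1) _ _ (hf _ vhr) (hf _ vr').
  have /hassum_bound := @hassum_linear _ _ _ _ (- h) _ _ h1 hS.
  rewrite mulN1r mulNr; apply=> s us.
  apply: (@le_trans _ _
      (\sum_(k <- s) (h / rho) ^+ 2 * (`|c k| * r ^+ mdeg k))).
    apply: (le_trans (ler_norm_sum _ _ _)); apply: ler_sum => k _.
    rewrite [X in `|X|](_ : _ = c k * (mono (v + h *: delta_mx ord0 i) k -
      mono v k - h * dmono i v k)); last by ring.
    rewrite normrM [leRHS]mulrCA; apply: ler_wpM2l => //.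
    by rewrite -rd; apply: mono_taylor1 => //; exact: ltW.
  rewrite -mulr_sumr [leRHS](_ : _ = (h / rho) ^+ 2 * B).
    by apply: ler_wpM2l; [exact: sqr_ge0|exact: hB].
  by rewrite expr_div_n; ring.
split.
  exists rho, (B / rho); split=> // v vr.
  have [S hS] := hs v vr.
  by have [_ ->] := hd _ _ vr hS.
near=> x.
have vr : `|x - a| <= rho.
  near: x; apply/nbhs_ballP; exists rho => //= y.
  by rewrite -ball_normE /ball_/= distrC => /ltW.
have [S hS] := hs _ vr.
by have [+ _] := hd _ _ vr hS; rewrite subrKC.
Unshelve. all: by end_near. Qed.

Lemma pser_near_eq (R : realType) (n : nat) (a : 'rV[R]_n) f g c :
  (\forall x \near a, f x = g x) -> pser a f c -> pser a g c.
Proof.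
move=> /nbhs_ballP[e /= e0 he] [r [B [r0 hB hf]]].
exists (Num.min r (e / 2)), B; split.
- by rewrite lt_min r0 divr_gt0.
- move=> s us; apply: pser_bound_shrink (hB _ us).
  have e20 : 0 < e / 2 by rewrite divr_gt0.
  by rewrite ge_min lexx le_min (ltW r0) (ltW e20).
move=> v; rewrite le_min => /andP[vr ve].
rewrite -he; first exact: hf.
rewrite -ball_normE /ball_/= opprD addrA subrr add0r normrN.
by apply: (le_lt_trans ve); lra.
Qed.

Lemma pser_at (R : realType) (n : nat) (a : 'rV[R]_n) f c :
  pser a f c -> f a = c [ffun=> 0%N].
Proof.
move=> [r [B [r0 hB hf]]].
have := hf 0; rewrite normr0 addr0 => /(_ (ltW r0)) h.
have E (k : {ffun 'I_n -> nat}) : k != [ffun=> 0%N] ->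
    c k * mono (0 : 'rV[R]_n) k = 0.
  move=> k0; have [i ki] : exists i, k i != 0%N.
    apply: contrapT => hk; move/eqP : k0; apply; apply/ffunP => i.
    by rewrite ffunE; apply/eqP/negPn/negP => ki; apply: hk; exists i.
  by rewrite /mono (bigD1 i)//= mxE expr0n (negPf ki) mul0r mulr0.
apply: hassum_unique h _ => e e0; exists [:: [ffun=> 0%N]] => s us sub.
rewrite (bigD1_seq [ffun=> 0%N])//=; last by apply: sub; rewrite inE.
rewrite [X in _ + X - _]big1 ?addr0; last by move=> k; exact: E.
rewrite /mono big1 ?mulr1 ?subrr ?normr0 ?ltW// => i _.
by rewrite ffunE expr0.
Qed.

Lemma finite_radius (R : realType) (I : finType) (P : I -> R -> R -> Prop) :
  (forall i r r' K K', r' <= r -> K <= K' -> P i r K -> P i r' K') ->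
  (forall i, exists r K : R, [/\ 0 < r, 0 <= K & P i r K]) ->
  exists r K : R, [/\ 0 < r, 0 <= K & forall i, P i r K].
Proof.
move=> mono_P exP.
have /choice[f hf] : forall i, exists rK : R * R,
    [/\ 0 < rK.1, 0 <= rK.2 & P i rK.1 rK.2].
  by move=> i; have [r [K h]] := exP i; exists (r, K).
(* The default value 1 keeps the radius positive when [I] is empty. *)
exists (\big[Num.min/1]_i (f i).1), (\sum_i (f i).2); split.
- by apply/bigmin_gtP; split=> // i _; have [] := hf i.
- by apply: sumr_ge0 => i _; have [] := hf i.
move=> i; have [_ _] := hf i; apply: mono_P.
  exact: bigmin_le_cond.
rewrite (bigD1 i)//= lerDl; apply: sumr_ge0 => j _.
by have [] := hf j.
Qed.

(** * Analytic vector fields *)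

Lemma analytic_field_lipschitz (R : realType) (n : nat)
    (X : 'rV[R]_n -> 'rV[R]_n) a : analytic_field X ->
  exists r L : R, [/\ 0 < r, 0 <= L &
    forall u v, `|u| <= r -> `|v| <= r ->
      `|X (a + u) - X (a + v)| <= L * `|u - v|].
Proof.
move=> anX.
have [|j|r [L [r0 L0 h]]] := @finite_radius R 'I_n (fun j r L => forall u v,
    `|u| <= r -> `|v| <= r ->
      `|X (a + u) ord0 j - X (a + v) ord0 j| <= L * `|u - v|).
- move=> j r r' K K' rr' KK' h u v ur vr.
  apply: (le_trans (h u v (le_trans ur rr') (le_trans vr rr'))).
  exact: ler_wpM2r.
- have [c /pser_lipschitz[r [L [r0 L0 h]]]] := analytic_pser (anX j a).
  by exists r, L.
exists r, L; split=> // u v ur vr; apply: norm_row_le => [|j].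
  exact: mulr_ge0.
by rewrite !mxE; exact: h.
Qed.

(** [iter_partial] adds derivatives on the outside, whereas the induction on the order peels off the
    innermost one, which acts on the expansion at hand. *)
Lemma iter_partial_rcons (R : realType) (n : nat) (s : seq 'I_n) i
    (f : 'rV[R]_n -> 'rV[R]_n) :
  iter_partial (rcons s i) f = iter_partial s ('D_(delta_mx ord0 i) f).
Proof. by elim: s => [//|j s ih] /=; rewrite ih. Qed.

(** The derivative of a row is computed coordinatewise where all coordinates are derivable. This is
    known near [a], which is enough for an expansion at [a]. *)
Lemma pser_derive_row (R : realType) (n : nat) (a : 'rV[R]_n)
    (f : 'rV[R]_n -> 'rV[R]_n) (c : 'I_n -> {ffun 'I_n -> nat} -> R) i :
  (forall j, pser a (fun x => f x ord0 j) (c j)) ->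
  forall j, pser a (fun x => ('D_(delta_mx ord0 i) f x) ord0 j)
    (fun k : {ffun 'I_n -> nat} => (k i).+1%:R * c j (mshift i k)).
Proof.
move=> hf j; have [+ _] := pser_derive i (hf j).
apply: pser_near_eq.
have : \forall x \near a, forall j : 'I_n,
    derivable (fun x => f x ord0 j) x (delta_mx ord0 i).
  apply: (filter_forall (nbhs_filter a)) => l.
  by have [_] := pser_derive i (hf l).
apply: filterS => x hx.
rewrite derive_mx ?mxE//; apply/derivable_mxP => i0 l.
by rewrite (ord1 i0).
Qed.

(** Induction on [N] with [f] and [g] varying: if [k i > 0], the coefficient at [k] is, up to the
    factor [k i], a coefficient of lower degree of the [i]-th partial derivative. The coefficient at
    0 is the value at [a]. *)
Lemma same_taylor_coef (R : realType) (n N : nat) (a : 'rV[R]_n)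
    (f g : 'rV[R]_n -> 'rV[R]_n) (c d : 'I_n -> {ffun 'I_n -> nat} -> R) :
  (forall j, pser a (fun x => f x ord0 j) (c j)) ->
  (forall j, pser a (fun x => g x ord0 j) (d j)) ->
  same_taylor N a f g -> forall j k, (mdeg k <= N)%N -> c j k = d j k.
Proof.
elim: N f g c d => [|N ih] f g c d hf hg fg j k kN;
  have fga : f a = g a by exact: (fg [::]).
  have -> : k = [ffun=> 0%N].
    apply/ffunP => i; rewrite ffunE; apply/eqP; rewrite -leqn0.
    by apply: leq_trans kN; rewrite /mdeg (bigD1 i)//= leq_addr.
  by rewrite -(pser_at (hf j)) -(pser_at (hg j)) fga.
have [k0|k0] := eqVneq k [ffun=> 0%N].
  by rewrite k0 -(pser_at (hf j)) -(pser_at (hg j)) fga.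
have [i ki] : exists i, (0 < k i)%N.
  apply: contrapT => hk; move/eqP : k0; apply; apply/ffunP => i.
  by rewrite ffunE; apply/eqP; rewrite -leqn0 leqNgt; apply/negP => ki;
    apply: hk; exists i.
have := @ih _ _ _ _ (pser_derive_row i hf) (pser_derive_row i hg) _ j
  (munshift i k).
rewrite munshiftK// => h; apply: (@mulfI _ (munshift i k i).+1%:R).
  by rewrite pnatr_eq0.
apply: h => [s sN|].
  by rewrite -!iter_partial_rcons fg// size_rcons.
by rewrite -ltnS -(mdeg_mshift i) munshiftK.
Qed.

Lemma same_taylor_flat (R : realType) (n N : nat) (a : 'rV[R]_n)
    (f g : 'rV[R]_n -> 'rV[R]_n) :
  analytic_field f -> analytic_field g -> same_taylor N a f g ->
  exists r K : R, [/\ 0 < r, 0 <= K &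
    forall v, `|v| <= r -> `|f (a + v) - g (a + v)| <= K * `|v| ^+ N.+1].
Proof.
move=> anf ang fg.
have /choice[c hc] : forall j, exists c, pser a (fun x => f x ord0 j) c.
  by move=> j; exact: analytic_pser.
have /choice[d hd] : forall j, exists c, pser a (fun x => g x ord0 j) c.
  by move=> j; exact: analytic_pser.
have cd := same_taylor_coef hc hd fg.
have [|j|r [K [r0 K0 h]]] := @finite_radius R 'I_n (fun j r K => forall v,
    `|v| <= r -> `|f (a + v) ord0 j - g (a + v) ord0 j| <= K * `|v| ^+ N.+1).
- move=> j r r' K K' rr' KK' h v vr.
  apply: (le_trans (h v (le_trans vr rr'))).
  by apply: ler_wpM2r => //; rewrite exprn_ge0.
- have /pser_flat : pser a (fun x => f x ord0 j - g x ord0 j)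
      (fun k => c j k - d j k).
    have [r [B [r0 hB hf]]] := hc j; have [r' [B' [r'0 hB' hg]]] := hd j.
    have m0 : 0 < Num.min r r' by rewrite lt_min r0.
    exists (Num.min r r'), (B + B'); split=> // [s us|v].
      have h1 : \sum_(k <- s) `|c j k| * Num.min r r' ^+ mdeg k <= B.
        by apply: pser_bound_shrink (hB _ us); rewrite (ltW m0) ge_min lexx.
      have h2 : \sum_(k <- s) `|d j k| * Num.min r r' ^+ mdeg k <= B'.
        by apply: pser_bound_shrink (hB' _ us);
          rewrite (ltW m0) ge_min lexx orbT.
      apply: le_trans (lerD h1 h2); rewrite -big_split /=.
      apply: ler_sum => k _; rewrite -mulrDl; apply: ler_wpM2r.
        by rewrite exprn_ge0// ltW.
      exact: ler_normB.
    rewrite le_min => /andP[vr vr'].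
    have := @hassum_linear _ _ _ _ (-1) _ _ (hf v vr) (hg v vr').
    by rewrite mulN1r; apply: hassum_ext => k; ring.
  move=> /(_ N.+1)[k kN|r [K [r0 K0 h]]]; last by exists r, K.
  by rewrite cd ?subrr.
exists r, K; split=> // v vr; apply: norm_row_le => [|j].
  by rewrite mulr_ge0// exprn_ge0.
by rewrite !mxE; exact: h.
Qed.

(** Source of the uniformity in the control: the entries of [u] are at most 1 in absolute value, so
    the bounds of the [m.+1] fields just add up. *)
Lemma ctrl_norm (R : realType) (n m : nat) (Z : 'I_m.+1 -> 'rV[R]_n)
    (u : 'rV[R]_m) K : unit_cube u -> (forall i, `|Z i| <= K) ->
  `|Z ord0 + \sum_(i < m) u ord0 i *: Z (lift ord0 i)| <= m.+1%:R * K.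
Proof.
move=> uU ZK; apply: (le_trans (ler_normD _ _)).
rewrite -natr1 addrC mulrDl mul1r; apply: lerD => //.
apply: (le_trans (ler_norm_sum _ _ _)).
rewrite mulr_natl -[m in leRHS]card_ord -sumr_const; apply: ler_sum => i _.
rewrite normrZ; apply: le_trans (ZK (lift ord0 i)).
by rewrite ler_piMl// ler_norml.
Qed.

Section ctrl_fields.
Variables (R : realType) (n m : nat).
Variables (X Y : 'I_m.+1 -> 'rV[R]_n -> 'rV[R]_n).
Hypotheses (anX : forall i, analytic_field (X i)).
Hypotheses (anY : forall i, analytic_field (Y i)).

Lemma ctrl_lipschitz a : exists r L : R, [/\ 0 < r, 0 <= L &
    forall w u v, unit_cube w -> `|u| <= r -> `|v| <= r ->
      `|ctrl_field X w (a + u) - ctrl_field X w (a + v)| <= L * `|u - v|].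
Proof.
have [|i|r [L [r0 L0 h]]] := @finite_radius R 'I_m.+1 (fun i r L =>
    forall u v, `|u| <= r -> `|v| <= r ->
      `|X i (a + u) - X i (a + v)| <= L * `|u - v|).
- move=> j r r' K K' rr' KK' h u v ur vr.
  apply: (le_trans (h u v (le_trans ur rr') (le_trans vr rr'))).
  exact: ler_wpM2r.
- exact: analytic_field_lipschitz.
exists r, (m.+1%:R * L); split=> // [|w u v wU ur vr]; first exact: mulr_ge0.
rewrite /ctrl_field opprD addrACA -sumrB.
under eq_bigr do rewrite -scalerBr.
rewrite -mulrA.
by apply: (@ctrl_norm _ _ _ (fun i => X i (a + u) - X i (a + v))) => // i;
  exact: h.
Qed.

Lemma ctrl_bounded a : exists r K : R, [/\ 0 < r, 0 <= K &
    forall w u, unit_cube w -> `|u| <= r -> `|ctrl_field X w (a + u)| <= K].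
Proof.
have [r [L [r0 L0 h]]] := ctrl_lipschitz a.
pose M := \sum_i `|X i a|.
have M0 : 0 <= M by exact: sumr_ge0.
exists r, (L * r + m.+1%:R * M); split=> // [|w u wU ur].
  by rewrite addr_ge0// mulr_ge0// ltW.
have := h w u 0 wU ur; rewrite normr0 addr0 subr0 => /(_ (ltW r0)) h1.
rewrite -[ctrl_field X w (a + u)](subrK (ctrl_field X w a)).
apply: (le_trans (ler_normD _ _)); apply: lerD.
  by apply: (le_trans h1); exact: ler_wpM2l.
apply: (@ctrl_norm _ _ _ (fun i => X i a)) => // i.
by rewrite /M (bigD1 i)//= lerDl sumr_ge0.
Qed.

Lemma ctrl_flat a N : (forall i, same_taylor N a (X i) (Y i)) ->
  exists r K : R, [/\ 0 < r, 0 <= K &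
    forall w v, unit_cube w -> `|v| <= r ->
      `|ctrl_field X w (a + v) - ctrl_field Y w (a + v)| <= K * `|v| ^+ N.+1].
Proof.
move=> XY.
have [|i|r [L [r0 L0 h]]] := @finite_radius R 'I_m.+1 (fun i r K =>
    forall v, `|v| <= r ->
      `|X i (a + v) - Y i (a + v)| <= K * `|v| ^+ N.+1).
- move=> j r r' K K' rr' KK' h v vr.
  apply: (le_trans (h v (le_trans vr rr'))).
  by apply: ler_wpM2r => //; rewrite exprn_ge0.
- exact: same_taylor_flat.
exists r, (m.+1%:R * L); split=> // [|w v wU vr]; first exact: mulr_ge0.
rewrite /ctrl_field opprD addrACA -sumrB.
under eq_bigr do rewrite -scalerBr.
rewrite -mulrA.
by apply: (@ctrl_norm _ _ _ (fun i => X i (a + v) - Y i (a + v))) => // i;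
  exact: h.
Qed.

End ctrl_fields.

(** * Curves and differential inequalities *)

Definition sqn (R : realType) (n : nat) (v : 'rV[R]_n) : R :=
  \sum_j v ord0 j ^+ 2.

Lemma sqn_ge0 (R : realType) (n : nat) (v : 'rV[R]_n) : 0 <= sqn v.
Proof. by apply: sumr_ge0 => j _; exact: sqr_ge0. Qed.

Lemma norm_sqr_le_sqn (R : realType) (n : nat) (v : 'rV[R]_n) :
  `|v| ^+ 2 <= sqn v.
Proof.
rewrite -[leRHS]sqr_sqrtr ?sqn_ge0// lerXn2r ?nnegrE ?sqrtr_ge0//.
apply: norm_row_le => [|j]; first exact: sqrtr_ge0.
rewrite -sqrtr_sqr ler_wsqrtr// /sqn (bigD1 j)//= lerDl sumr_ge0// => i _.
exact: sqr_ge0.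
Qed.

Lemma sqn_le_norm (R : realType) (n : nat) (v : 'rV[R]_n) K :
  `|v| <= K -> sqn v <= n%:R * K ^+ 2.
Proof.
move=> vK; rewrite mulr_natl -[n in leRHS]card_ord -sumr_const.
apply: ler_sum => j _; rewrite -[leLHS]real_normK ?num_real//.
apply: lerXn2r; rewrite ?nnegrE//; first exact: le_trans (normr_ge0 _) vK.
exact: le_trans (coord_norm_le _ _) vK.
Qed.

Lemma sqn_continuous (R : realType) (n : nat) : continuous (@sqn R n).
Proof.
have -> : @sqn R n = \sum_(j < n) (fun v : 'rV[R]_n => v ord0 j ^+ 2).
  by apply/funext => v; rewrite fct_sumE.
move=> v; apply: (big_ind (fun f : 'rV[R]_n -> R => {for v, continuous f})).
- by apply: (@cst_continuous 'rV[R]_n R 0 v).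
- by move=> f g cf cg; exact: continuousD.
- move=> j _.
  by apply: (@continuousM _ _ (fun v : 'rV[R]_n => v ord0 j)
    (fun v : 'rV[R]_n => v ord0 j)); exact: coord_continuous.
Qed.

Lemma within_coord (R : realType) (n : nat) (A : set R) (g : R -> 'rV[R]_n) j :
  {within A, continuous g} -> {within A, continuous (fun s => g s ord0 j)}.
Proof.
move=> cg s.
apply: (@continuous_comp _ _ _ (g : subspace A -> 'rV[R]_n)
  (fun M : 'rV[R]_n => M ord0 j)); first exact: cg.
exact: coord_continuous.
Qed.

Lemma is_derive_coord (R : realType) (n : nat) (g : R -> 'rV[R]_n)
    (s : R) (v : 'rV[R]_n) (j : 'I_n) :
  is_derive s 1 g v -> is_derive s 1 (fun s => g s ord0 j) (v ord0 j).
Proof.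
move=> [dg <-]; apply: DeriveDef.
  by move/derivable_mxP : dg; exact.
by rewrite derive_mx// mxE.
Qed.

(** Mean value theorem in each coordinate; with the sup norm no factor depending on [n] appears. *)
Lemma curve_increment (R : realType) (n : nat) (g dg : R -> 'rV[R]_n)
    (a b K : R) : a <= b -> 0 <= K -> {within `[a, b], continuous g} ->
  (forall s, a < s < b -> is_derive s 1 g (dg s) /\ `|dg s| <= K) ->
  `|g b - g a| <= K * (b - a).
Proof.
move=> ab K0 cg hg; apply: norm_row_le => [|j].
  by rewrite mulr_ge0// subr_ge0.
rewrite !mxE; move: ab; rewrite le_eqVlt => /predU1P[->|ab].
  by rewrite !subrr normr0 mulr0.
have [s|c] := @MVT R (fun s => g s ord0 j) (fun s => dg s ord0 j) a b ab _
    (within_coord (j := j) cg).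
  by rewrite in_itv/= => /hg[h _]; exact: is_derive_coord.
rewrite in_itv/= => /hg[_ h] ->; rewrite normrM [`|b - a|]gtr0_norm ?subr_gt0//.
apply: ler_wpM2r; first by rewrite subr_ge0 ltW.
exact: le_trans (coord_norm_le _ _) h.
Qed.

Lemma is_derive_mull (R : realType) (b s : R) :
  is_derive s (1 : R) (fun s : R => b * s) b.
Proof.
apply: (@is_derive_quadratic _ _ _ _ _ _ 0 1) => // h _.
by rewrite mul0r [X in `|X|](_ : _ = 0) ?normr0// /GRing.scale/=; ring.
Qed.

Lemma gronwall (R : realType) (f df : R -> R) (S a b : R) :
  0 <= S -> 0 <= a -> 0 <= b -> {within `[0, S], continuous f} ->
  (forall s, 0 < s < S -> is_derive s 1 f (df s) /\ df s <= a * f s + b) ->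
  f S <= (f 0 + b * S) * expR (a * S).
Proof.
move=> + a0 b0 cf hf.
rewrite le_eqVlt => /predU1P[<-|S0]; first by rewrite !mulr0 expR0 mulr1 addr0.
pose e s := expR (- a * s).
have de s : is_derive s (1 : R) e (- a * e s).
  have := is_derive1_comp (is_derive_expR (- a * s)) (is_derive_mull (- a) s).
  by rewrite mulrC.
(* [chi] has nonpositive derivative: [(df - a f) e - b <= b e - b <= 0], because [e <= 1] for
   nonnegative times. *)
pose chi s := f s * e s - b * s.
have dchi s : 0 < s < S ->
    is_derive s (1 : R) chi ((df s - a * f s) * e s - b).
  move=> /hf[dfs _].
  have h1 := @is_deriveM _ _ _ _ _ _ _ _ dfs (de s).
  have := is_deriveB h1 (is_derive_mull b s).
  by rewrite (_ : _ - _ = (df s - a * f s) * e s - b)//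
    /GRing.scale/=; ring.
have cchi : {within `[0, S], continuous chi}.
  have ce : continuous e.
    move=> s; apply: differentiable_continuous; apply/derivable1_diffP.
    by have [] := de s.
  move=> s; apply: (@continuousB _ _ _ (fun s : subspace `[0, S] => f s * e s)
    (fun s : subspace `[0, S] => b * s)).
    apply: (@continuousM _ _ (f : subspace `[0, S] -> R)
      (e : subspace `[0, S] -> R)); first exact: cf.
    exact: (continuous_subspaceT ce).
  apply: (@continuous_subspaceT _ _ _ (fun s : R => b * s)) => x.
  apply: differentiable_continuous; apply/derivable1_diffP.
  by have [] := is_derive_mull b x.
have [c] := MVT S0 dchi cchi.
rewrite in_itv/= => cS; rewrite {1 2}/chi /e !mulr0 expR0 mulr1 subr0 => h.
have [_ dle] := hf _ cS.
have e1 : e c <= 1.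
  rewrite -expR0 ler_expR mulNr oppr_le0 mulr_ge0//.
  by case/andP : cS => /ltW.
have ec0 : 0 < e c by exact: expR_gt0.
have dn : (df c - a * f c) * e c - b <= 0.
  rewrite subr_le0; apply: (@le_trans _ _ (b * e c)).
    by apply: ler_wpM2r; [exact: ltW|lra].
  by rewrite ler_piMr.
have : f S * e S - b * S <= f 0.
  rewrite -subr_le0 h subr0; exact: mulr_le0_ge0 dn (ltW S0).
rewrite lerBlDr => h1.
rewrite -(ler_pM2r (expR_gt0 (- a * S))) -mulrA -expRD mulNr subrr expR0 mulr1.
by rewrite -mulNr.
Qed.

(* The squared Euclidean norm is used because it is differentiable. The price is
   a bound of order D * sqrt S for the norm, instead of D * S. *)
Lemma curve_gronwall (R : realType) (n : nat) (g h dg dh : R -> 'rV[R]_n)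
    (S L D : R) : 0 <= S -> 0 <= L -> 0 <= D ->
  {within `[0, S], continuous g} -> {within `[0, S], continuous h} ->
  (forall s, 0 < s < S ->
    [/\ is_derive s 1 g (dg s), is_derive s 1 h (dh s) &
        `|dg s - dh s| <= L * `|g s - h s| + D]) ->
  sqn (g S - h S) <= (sqn (g 0 - h 0) + 2 * n%:R * D ^+ 2 * S) *
    expR ((1 + 2 * n%:R * L ^+ 2) * S).
Proof.
move=> S0 L0 D0 cg ch hgh.
apply: (@gronwall _ (fun s => sqn (g s - h s))
  (fun s => \sum_j 2 * (g s ord0 j - h s ord0 j) * (dg s ord0 j - dh s ord0 j)))
  => //.
- by rewrite addr_ge0// !mulr_ge0// sqr_ge0.
- by rewrite !mulr_ge0// sqr_ge0.
- move=> s; apply: (@continuous_comp _ _ _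
    (fun s : subspace `[0, S] => g s - h s) (@sqn R n)).
    by apply: continuousB; [exact: cg|exact: ch].
  exact: sqn_continuous.
- move=> s /hgh[dgs dhs bnd]; split.
    have -> : (fun s => sqn (g s - h s)) =
        \sum_(j < n) (fun s => (g s ord0 j - h s ord0 j) ^+ 2).
      apply/funext => x; rewrite fct_sumE; apply: eq_bigr => j _.
      by rewrite !mxE.
    apply: is_derive_sum => j.
    have := @is_deriveX _ _ _ 2 _ _ _
      (is_deriveB (is_derive_coord j dgs) (is_derive_coord j dhs)).
    rewrite /GRing.scale/= expr1.
    by [].
  (* Two applications of [2 x y <= x^2 + y^2], here and in [h3], are the origin of the constants
     [1 + 2 n L^2] and [2 n D^2]. *)
  apply: (@le_trans _ _ (sqn (g s - h s) + sqn (dg s - dh s))).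
    rewrite /sqn -big_split /=; apply: ler_sum => j _; rewrite !mxE.
    have := sqr_ge0 ((g s ord0 j - h s ord0 j) - (dg s ord0 j - dh s ord0 j)).
    by nra.
  have h1 := sqn_le_norm bnd.
  have h2 := norm_sqr_le_sqn (g s - h s).
  have h3 : (L * `|g s - h s| + D) ^+ 2 <=
      2 * L ^+ 2 * `|g s - h s| ^+ 2 + 2 * D ^+ 2.
    by have := sqr_ge0 (L * `|g s - h s| - D); nra.
  have h4 : 2 * L ^+ 2 * `|g s - h s| ^+ 2 <= 2 * L ^+ 2 * sqn (g s - h s).
    by apply: ler_wpM2l => //; rewrite mulr_ge0// sqr_ge0.
  have h5 : n%:R * (L * `|g s - h s| + D) ^+ 2 <=
      n%:R * (2 * L ^+ 2 * sqn (g s - h s) + 2 * D ^+ 2).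
    by apply: ler_wpM2l => //; lra.
  rewrite mulrDl mul1r -addrA lerD2l.
  apply: (le_trans h1); apply: (le_trans h5).
  by rewrite le_eqVlt; apply/orP; left; apply/eqP; ring.
Qed.

(* The first time at which [f >= 1] would be an infimum where [f < 1]. *)
Lemma continuity_trap (R : realType) (f : R -> R) (S : R) :
  {within `[0, S], continuous f} ->
  (forall s, 0 <= s <= S -> (forall r, 0 <= r < s -> f r < 1) -> f s < 1) ->
  forall s, 0 <= s <= S -> f s < 1.
Proof.
move=> cf hf s sS; rewrite ltNge; apply/negP => fs1.
pose A := [set r | 0 <= r <= S /\ 1 <= f r].
have infA : has_inf A.
  by split; [exists s|exists 0 => r [/andP[]]].
pose i := inf A.
have i0 : 0 <= i by apply: lb_le_inf; [exact: infA.1|move=> r [/andP[]]].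
have iS : i <= S.
  apply: (@le_trans _ _ s); last by case/andP : sS.
  by apply: ge_inf; [exact: infA.2|].
have fi : f i < 1.
  apply: hf => [|r /andP[r0 ri]]; first by rewrite i0.
  rewrite ltNge; apply/negP => fr.
  suff : i <= r by rewrite leNgt ri.
  apply: ge_inf; first exact: infA.2.
  by split=> //; rewrite r0 (le_trans (ltW ri) iS).
have iI : `[0, S]%classic i by rewrite /= in_itv/= i0.
have : \forall r \near within `[0, S]%classic (nbhs i), f r < 1.
  move/subspace_continuousP : cf => /(_ i iI) h.
  exact: (@cvgr_lt _ _ _ _ f (f i) h 1 fi).
move=> /nbhs_ballP[d /= d0 hd].
have [r [rS fr] ri] := inf_adherent d0 infA.
have : f r < 1.
  apply: hd; last by rewrite in_itv.
  have ir : i <= r by apply: ge_inf; [exact: infA.2|].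
  rewrite /ball/= distrC ger0_norm ?subr_ge0//.
  by rewrite ltrBlDl.
by rewrite ltNge fr.
Qed.

(** * Flows of locally Lipschitz fields *)

Definition locally_lipschitz (R : realType) (n : nat)
    (V : 'rV[R]_n -> 'rV[R]_n) : Prop :=
  forall a, exists r L : R, [/\ 0 < r, 0 <= L &
    forall u v, `|u| <= r -> `|v| <= r ->
      `|V (a + u) - V (a + v)| <= L * `|u - v|].

Definition complete_field (R : realType) (n : nat)
    (V : 'rV[R]_n -> 'rV[R]_n) : Prop :=
  forall x S, 0 < S -> exists g : R -> 'rV[R]_n,
    g 0 = x /\ integral_curve set0 (fun=> V) S g.

Lemma sqn0 (R : realType) (n : nat) : sqn (0 : 'rV[R]_n) = 0.
Proof. by rewrite /sqn big1// => j _; rewrite mxE expr0n. Qed.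

Lemma continuous_eps (R : realType) (V W : normedModType R) (f : V -> W) a :
  (forall e : R, 0 < e -> exists2 d : R, 0 < d &
    forall x, `|x - a| < d -> `|f x - f a| <= e) -> {for a, continuous f}.
Proof.
move=> h B /nbhs_ballP[e /= e0 eB].
have e20 : 0 < e / 2 by rewrite divr_gt0.
have [d d0 hd] := h _ e20.
apply/nbhs_ballP; exists d => //= x; rewrite -ball_normE /ball_/= => xd.
apply: eB; rewrite -ball_normE /ball_/= distrC.
by apply: (le_lt_trans (hd x _)); rewrite 1?distrC//; lra.
Qed.

Section autonomous_fields.
Variables (R : realType) (n : nat) (V : 'rV[R]_n -> 'rV[R]_n).
Hypothesis lipV : locally_lipschitz V.

Lemma locally_lipschitz_continuous : continuous V.
Proof.
move=> a; apply: continuous_eps => e e0; have [r [L [r0 L0 h]]] := lipV a.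
have d0 : 0 < e / (L + 1) by rewrite divr_gt0// ltr_wpDl.
exists (Num.min r (e / (L + 1))); first by rewrite lt_min r0.
move=> x; rewrite lt_min => /andP[/ltW xr /ltW xe].
have := h (x - a) 0 xr; rewrite normr0 addr0 subr0 subrKC => /(_ (ltW r0)) h1.
apply: (le_trans h1).
apply: (@le_trans _ _ ((L + 1) * (e / (L + 1)))).
  by apply: ler_pM => //; rewrite lerDl.
by rewrite mulrC divfK// gt_eqF// ltr_wpDl.
Qed.

(* The set of pairs where the Lipschitz inequality holds with constant L grows
   with L and eventually contains a neighbourhood of each pair: by hypothesis on
   the diagonal, by continuity of V off it. *)
Lemma locally_lipschitz_ball rho : exists2 L, 0 <= L &
  forall x y, `|x| <= rho -> `|y| <= rho -> `|V x - V y| <= L * `|x - y|.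
Proof.
pose K := [set x : 'rV[R]_n | `|x| <= rho].
have cK : compact K.
  apply: bounded_closed_compact.
    exists rho; split; first by rewrite num_real.
    by move=> M rM x /= /le_trans; apply; exact: ltW.
  have -> : K = Num.norm @^-1` [set x | x <= rho] by [].
  apply: closed_comp; last exact: closed_le.
  by move=> x _; exact: norm_continuous.
have /compact_near_coveringP cKK := compact_setX cK cK.
pose P (L : R) (z : 'rV[R]_n * 'rV[R]_n) :=
  `|V z.1 - V z.2| <= L * `|z.1 - z.2|.
have locP x y : exists r M : R, 0 < r /\ forall z M', `|z.1 - x| < r ->
    `|z.2 - y| < r -> M < M' -> P M' z.
  have [->|xy] := eqVneq x y.
    have [r [L [r0 L0 h]]] := lipV y.
    exists r, L; split=> // z M' /ltW z1 /ltW z2 LM; rewrite /P.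
    have := h _ _ z1 z2; rewrite !subrKC opprB addrA subrK => h1.
    by apply: (le_trans h1); apply: ler_wpM2r => //; exact: ltW.
  pose d := `|x - y|.
  have d0 : 0 < d by rewrite normr_gt0 subr_eq0.
  have [r r0 hr] : exists2 r : R, 0 < r & forall u, `|u - x| < r ->
      `|V u - V x| < 1.
    have /nbhs_ballP[r /= r0 hr] :=
      locally_lipschitz_continuous (nbhsx_ballx (V x) _ ltr01).
    exists r => // u ux; have := hr u; rewrite -!ball_normE /ball_/= distrC.
    by move=> /(_ ux); rewrite distrC.
  have [r' r'0 hr'] : exists2 r : R, 0 < r & forall u, `|u - y| < r ->
      `|V u - V y| < 1.
    have /nbhs_ballP[q /= q0 hq] :=
      locally_lipschitz_continuous (nbhsx_ballx (V y) _ ltr01).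
    exists q => // u uy; have := hq u; rewrite -!ball_normE /ball_/= distrC.
    by move=> /(_ uy); rewrite distrC.
  pose M0 := `|V x - V y| + 2.
  (* If both points move by less than [d / 4], they stay at least [d / 2] apart, while each value of
     [V] moves by less than 1, whence the 2 in [M0]. *)
  exists (Num.min (d / 4) (Num.min r r')), (M0 / (d / 2)); split.
    by rewrite !lt_min r0 r'0 divr_gt0.
  move=> z M'; rewrite !lt_min => /and3P[z1d z1r _] /and3P[z2d _ z2r] MM'.
  have zd : d / 2 <= `|z.1 - z.2|.
    have : d <= `|z.1 - z.2| + (`|z.1 - x| + `|z.2 - y|).
      rewrite /d [x - y](_ : _ = (z.1 - z.2) - ((z.1 - x) - (z.2 - y))).
        apply: (le_trans (ler_normB _ _)); rewrite lerD2l.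
        exact: ler_normB.
      by rewrite !opprB; apply/matrixP => i j; rewrite !mxE; ring.
    lra.
  have zM : `|V z.1 - V z.2| <= M0.
    rewrite [V z.1 - V z.2](_ : _ =
      (V x - V y) + ((V z.1 - V x) - (V z.2 - V y))).
      apply: (le_trans (ler_normD _ _)); rewrite lerD2l.
      apply: (le_trans (ler_normB _ _)).
      by have := hr _ z1r; have := hr' _ z2r; lra.
    by apply/matrixP => i j; rewrite !mxE; ring.
  rewrite /P; apply: (le_trans zM).
  apply: (@le_trans _ _ (M0 / (d / 2) * (d / 2))).
    by rewrite divfK// gt_eqF// divr_gt0.
  have M00 : 0 <= M0 / (d / 2) by rewrite divr_ge0// ?addr_ge0// divr_ge0// ltW.
  by apply: ler_pM => //; [rewrite divr_ge0// ltW|exact: ltW].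
have : \forall L \near +oo, K `*` K `<=` P L.
  apply: cKK => -[x y] _; have [r [M [r0 h]]] := locP x y.
  exists ([set z | `|z.1 - x| < r /\ `|z.2 - y| < r], [set M' | M < M']).
    split=> /=; last by exists M; split => //; exact: num_real.
    exists (ball x r, ball y r).
      by split; exact: nbhsx_ballx.
    by move=> z /=; rewrite -!ball_normE /ball_/= ![`|_ - z.1|]distrC
      ![`|_ - z.2|]distrC.
  by move=> [z M'] /= [[z1 z2] MM']; exact: h.
move=> [M [_ hM]].
exists (Num.max 0 (M + 1)); first by rewrite le_max lexx.
move=> x y xr yr.
have : P (M + 1) (x, y) by apply: hM; rewrite ?ltrDl.
move=> /le_trans; apply; apply: ler_wpM2r => //.
by rewrite le_max lexx orbT.
Qed.

Lemma integral_curve_cont S (W : 'rV[R]_n -> 'rV[R]_n) g :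
  integral_curve set0 (fun=> W) S g -> {within `[0, S], continuous g}.
Proof. by case. Qed.

Lemma integral_curve_derive S (W : 'rV[R]_n -> 'rV[R]_n) g s :
  integral_curve set0 (fun=> W) S g -> 0 < s < S -> is_derive s 1 g (W (g s)).
Proof. by move=> [_ h] sS; apply: h => //; rewrite /= in_itv. Qed.

Lemma integral_curve_restrict S s (W : 'rV[R]_n -> 'rV[R]_n) g :
  s <= S -> integral_curve set0 (fun=> W) S g ->
  integral_curve set0 (fun=> W) s g.
Proof.
move=> sS [cg hg]; split.
  by apply: continuous_subspaceW cg; apply: subset_itvl; rewrite bnd_simp.
move=> r; rewrite /= in_itv/= => /andP[r0 rs]; apply: hg.
by rewrite /= in_itv/= r0 (lt_le_trans rs).
Qed.

Lemma curve_bounded S (g : R -> 'rV[R]_n) : {within `[0, S], continuous g} ->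
  exists2 rho, 0 <= rho & forall s, 0 <= s <= S -> `|g s| <= rho.
Proof.
move=> cg.
have /compact_bounded[M [_ hM]] :
  compact (g @` `[0, S]%classic).
  by apply: continuous_compact => //; exact: segment_compact.
exists (Num.max 0 (M + 1)); first by rewrite le_max lexx.
move=> s sS; rewrite le_max; apply/orP; right.
by apply: hM; rewrite ?ltrDl//; exists s => //=; rewrite in_itv.
Qed.

(** Both curves lie in one ball, where a single Lipschitz constant is available; Gronwall with
    [D = 0] concludes. *)
Lemma integral_curve_unique S g h : 0 <= S ->
  integral_curve set0 (fun=> V) S g -> integral_curve set0 (fun=> V) S h ->
  g 0 = h 0 -> g S = h S.
Proof.
move=> S0 ig ih gh0.
have cg := integral_curve_cont ig; have ch := integral_curve_cont ih.
have [r r0 hr] := curve_bounded cg; have [r' r'0 hr'] := curve_bounded ch.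
have [L L0 hL] := locally_lipschitz_ball (Num.max r r').
have := @curve_gronwall R n g h (V \o g) (V \o h) S L 0 S0 L0 (lexx _) cg ch.
rewrite gh0 subrr sqn0 expr0n mulr0 mul0r addr0 mul0r => hle.
have /(le_trans (norm_sqr_le_sqn _)) : sqn (g S - h S) <= 0.
  apply: hle => s sS; split; [exact: integral_curve_derive ig sS|
    exact: integral_curve_derive ih sS|].
  have s0S : 0 <= s <= S by case/andP : sS => /ltW -> /ltW.
  by rewrite addr0; apply: hL; rewrite le_max ?hr ?hr' ?orbT.
move=> h2; apply/eqP.
by rewrite -subr_eq0 -normr_eq0 -sqrf_eq0 eq_le h2 sqr_ge0.
Qed.

(** For [s = 0] the condition on the derivative is void and every admissible end point is [x]. This
    is what makes blocks run for time 0 disappear. *)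
Lemma flow0 (W : 'rV[R]_n -> 'rV[R]_n) x : flow W 0 x = x.
Proof.
rewrite /flow; set A := [set y | _].
have : A x.
  exists (cst x); split=> //; split.
    by apply: continuous_subspaceT => s; exact: cst_continuous.
  by move=> s; rewrite /= in_itv/= => /andP[s0] /(lt_trans s0); rewrite ltxx.
by move=> Ax; have [g [g0 _ g1]] := getI Ax; rewrite -g1 -g0.
Qed.

Lemma flowP (W : 'rV[R]_n -> 'rV[R]_n) s x : complete_field W -> 0 <= s ->
  exists g, [/\ g 0 = x, integral_curve set0 (fun=> W) s g & g s = flow W s x].
Proof.
move=> cW; rewrite le_eqVlt => /predU1P[<-|s0].
  exists (cst x); split=> //; last by rewrite flow0.
  split; first by apply: continuous_subspaceT => s'; exact: cst_continuous.
  by move=> s'; rewrite /= in_itv/= => /andP[s0] /(lt_trans s0); rewrite ltxx.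
have [g [g0 ig]] := cW x s s0.
rewrite /flow; set A := [set y | _].
have Ag : A (g s) by exists g.
exact: (getI Ag).
Qed.

Hypothesis complV : complete_field V.

Lemma flow_integral_curve S s g : 0 <= s <= S ->
  integral_curve set0 (fun=> V) S g -> flow V s (g 0) = g s.
Proof.
move=> /andP[s0 sS] ig.
have [h [h0 ih <-]] := flowP (g 0) complV s0.
by apply: integral_curve_unique ih (integral_curve_restrict sS ig) h0.
Qed.

(** The Lipschitz constant on the ball of radius [rho + 1] applies to a neighbouring curve only as
    long as it stays in that ball, that is, within [d <= 1] of [g]. Gronwall up to a time [r] needs
    this only before [r], so [continuity_trap] closes the loop. Since [s0 > 0], nearby times are
    positive as well. *)
Lemma flow_continuous s0 x0 : 0 < s0 ->
  {for (s0, x0), continuous (fun z : R * 'rV[R]_n => flow V z.1 z.2)}.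
Proof.
move=> s0_gt0; pose S := s0 + 1.
have s0S : s0 < S by rewrite ltrDl.
have S0 : 0 < S by exact: lt_trans s0S.
have [g [g0 ig]] := complV x0 S0.
have cg := integral_curve_cont ig.
have [rho rho0 hrho] := curve_bounded cg.
have [L L0 hL] := locally_lipschitz_ball (rho + 1).
pose a := 1 + 2 * n%:R * L ^+ 2.
have a0 : 0 <= a by rewrite addr_ge0// !mulr_ge0// sqr_ge0.
pose E := expR (a * S); have E0 : 0 < E by exact: expR_gt0.
have close d x h : 0 < d <= 1 -> sqn (x0 - x) < d ^+ 2 / E ->
    h 0 = x -> integral_curve set0 (fun=> V) S h ->
    forall s, 0 <= s <= S -> `|g s - h s| < d.
  move=> /andP[d0 d1] xd h0 ih s sS.
  have ch := integral_curve_cont ih.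
  (* Normalized so that [f < 1] forces [h] to be within [d] of [g]. *)
  pose f s := d ^- 2 * sqn (g s - h s).
  have fd r : f r < 1 -> `|g r - h r| < d.
    rewrite /f mulrC ltr_pdivrMr ?exprn_gt0// mul1r.
    move=> /(le_lt_trans (norm_sqr_le_sqn _)).
    by rewrite ltr_pXn2r ?nnegrE ?(ltW d0).
  apply: (fd); apply: (@continuity_trap _ f S) => //.
    move=> r; apply: (@continuousM _ _ (cst (d ^- 2) : subspace `[0, S] -> R)
      (fun s : subspace `[0, S] => sqn (g s - h s))).
      by apply: continuous_subspaceT => ?; exact: cst_continuous.
    apply: (@continuous_comp _ _ _
      (fun s : subspace `[0, S] => g s - h s) (@sqn R n)).
      by apply: continuousB; [exact: cg|exact: ch].
    exact: sqn_continuous.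
  move=> r /andP[r0 rS] hf.
  have igr := integral_curve_restrict rS ig.
  have ihr := integral_curve_restrict rS ih.
  have := @curve_gronwall R n g h (V \o g) (V \o h) r L 0 r0 L0 (lexx _)
    (integral_curve_cont igr) (integral_curve_cont ihr).
  rewrite expr0n mulr0 mul0r addr0 -/a g0 h0 => hle.
  rewrite /f mulrC ltr_pdivrMr ?exprn_gt0// mul1r.
  apply: (@le_lt_trans _ _ (sqn (x0 - x) * E)); last by rewrite -ltr_pdivlMr.
  apply: (@le_trans _ _ (sqn (x0 - x) * expR (a * r))); last first.
    by apply: ler_wpM2l; [exact: sqn_ge0|rewrite ler_expR ler_wpM2l].
  apply: hle => q qr; split; [exact: integral_curve_derive igr qr|
    exact: integral_curve_derive ihr qr|].
  have /andP[q0 q1] := qr.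
  have gq : `|g q| <= rho by apply: hrho; rewrite !ltW// (lt_le_trans q1).
  have hq : `|g q - h q| < d by apply: fd; apply: hf; rewrite ltW.
  rewrite addr0; apply: hL; first by apply: (le_trans gq); rewrite lerDl.
  have -> : h q = g q - (g q - h q) by rewrite opprB addrC subrK.
  by apply: (le_trans (ler_normB _ _)); apply: lerD => //; lra.
apply: continuous_eps => /= e e0.
pose d := Num.min 1 (e / 2).
have d0 : 0 < d by rewrite lt_min ltr01 divr_gt0.
have [r r0 hr] : exists2 r : R, 0 < r &
    forall s, `|s - s0| < r -> 0 < s < S /\ `|g s - g s0| < e / 2.
  have cs : {for s0, continuous g}.
    by apply: within_continuous_continuous S0 cg _; rewrite in_itv/= s0_gt0.
  have e20 : 0 < e / 2 by rewrite divr_gt0.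
  have /nbhs_ballP[r /= r0 hr] := cs _ (nbhsx_ballx (g s0) _ e20).
  exists (Num.min r (Num.min 1 s0)); first by rewrite !lt_min r0 ltr01.
  move=> s; rewrite !lt_min => /and3P[sr s1 s2]; split.
    move: s1 s2; rewrite !ltr_norml /S; lra.
  have := hr s; rewrite -!ball_normE /ball_/= [`|s0 - s|]distrC => /(_ sr).
  by rewrite distrC.
have [q q0 hq] : exists2 q : R, 0 < q &
    forall x, `|x - x0| < q -> sqn (x0 - x) < d ^+ 2 / E.
  have dE : 0 < d ^+ 2 / E / (n%:R + 1).
    by rewrite !divr_gt0 ?exprn_gt0// ltr_wpDl.
  exists (Num.min 1 (d ^+ 2 / E / (n%:R + 1))); first by rewrite lt_min ltr01.
  move=> x; rewrite lt_min => /andP[x1 xd].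
  apply: (le_lt_trans (sqn_le_norm (lexx _))); rewrite distrC.
  apply: (@le_lt_trans _ _ ((n%:R + 1) * `|x - x0|)); last first.
    by rewrite mulrC -ltr_pdivlMr// ltr_wpDl.
  apply: ler_pM; rewrite ?sqr_ge0 ?lerDl//.
  by rewrite expr2 ler_piMl// ltW.
exists (Num.min r q); first by rewrite lt_min r0.
move=> z; rewrite lt_min => /andP[zr zq].
have z1 : `|z.1 - s0| < r.
  by apply: le_lt_trans zr; rewrite [leRHS]/Num.norm/= le_max lexx.
have z2 : `|z.2 - x0| < q.
  by apply: le_lt_trans zq; rewrite [leRHS]/Num.norm/= le_max lexx orbT.
have [zs zg] := hr _ z1; have zx := hq _ z2.
have [h [h0 ih]] := complV z.2 S0.
have zS : 0 <= z.1 <= S by case/andP : zs => /ltW -> /ltW.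
rewrite -{1}g0 (@flow_integral_curve S s0)// ?(ltW s0_gt0) ?(ltW s0S)//.
rewrite -h0 (@flow_integral_curve S)//.
rewrite -[h z.1](subrK (g z.1)) -addrA.
apply: (le_trans (ler_normD _ _)); rewrite (splitr e); apply: lerD.
  apply: (@le_trans _ _ d); last by rewrite ge_min lexx orbT.
  by rewrite distrC; apply/ltW/(close d z.2) => //; rewrite d0 ge_min lexx.
exact: ltW.
Qed.

End autonomous_fields.

(** * Piecewise constant controls *)

Lemma ctrl_locally_lipschitz (R : realType) (n m : nat)
    (X : 'I_m.+1 -> 'rV[R]_n -> 'rV[R]_n) (w : 'rV[R]_m) :
  (forall i, analytic_field (X i)) -> unit_cube w ->
  locally_lipschitz (ctrl_field X w).
Proof.
move=> anX wU a; have [r [L [r0 L0 h]]] := ctrl_lipschitz anX a.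
by exists r, L; split=> // u v ur vr; exact: h.
Qed.

Lemma ctrl_complete (R : realType) (n m : nat)
    (X : 'I_m.+1 -> 'rV[R]_n -> 'rV[R]_n) (U : set 'rV[R]_m) w :
  complete_switching X U -> U w -> complete_field (ctrl_field X w).
Proof.
move=> cX Uw x S S0.
(* With a single block the only switching time is 0, which lies outside the open interval. *)
have [g [g0 [cg hg]]] := cX 0%N (fun=> w) (fun=> S) (fun=> Uw) (fun=> S0) x.
exists g; split=> //; rewrite big_ord1 in cg hg.
split=> // s sS _; apply: hg => // -[j].
rewrite big1; last by move=> k; rewrite (ord1 j) (ord1 k).
by move=> s0; move: sS; rewrite s0 /= in_itv/= ltxx.
Qed.

Lemma flow_comp_continuous (R : realType) (n m p : nat)
    (Y : 'I_m.+1 -> 'rV[R]_n -> 'rV[R]_n) (U : set 'rV[R]_m) x0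
    (w : 'I_p -> 'rV[R]_m) (tau : 'rV[R]_p) :
  (forall i, analytic_field (Y i)) -> standing_assumption Y U ->
  (forall j, U (w j)) -> (forall j, 0 < tau ord0 j) ->
  {for tau, continuous (flow_comp Y x0 w)}.
Proof.
move=> anY [cY UE] wU tau0; rewrite /flow_comp.
elim: (enum 'I_p) => [|j s ih] /=; first exact: cst_continuous.
pose G (t : 'rV[R]_p) := foldr (fun (j : 'I_p) y =>
  flow (ctrl_field Y (w j)) (t ord0 j) y) x0 s.
apply: (@continuous_comp _ _ _ (fun t : 'rV[R]_p => (t ord0 j, G t))
  (fun z => flow (ctrl_field Y (w j)) z.1 z.2)).
  move=> B [[B1 B2] /= [nB1 nB2] B12].
  have n1 : nbhs tau [set t : 'rV[R]_p | B1 (t ord0 j)].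
    exact: coord_continuous nB1.
  have n2 : nbhs tau [set t : 'rV[R]_p | B2 (G t)] by exact: ih nB2.
  apply: (@filterS _ _ (nbhs_filter tau) _ _ _
    (@filterI _ _ (nbhs_filter tau) _ _ n1 n2)) => t [t1 t2].
  exact: B12.
apply: flow_continuous => //.
  by apply: ctrl_locally_lipschitz => //; rewrite -UE.
exact: ctrl_complete cY (wU j).
Qed.

Lemma enorm_le (R : realType) (n : nat) (v : 'rV[R]_n) K :
  `|v| <= K -> enorm v <= n.+1%:R * K.
Proof.
move=> vK; have K0 : 0 <= K by exact: le_trans vK.
rewrite -[leRHS]ger0_norm ?mulr_ge0// -sqrtr_sqr ler_wsqrtr//.
apply: (le_trans (sqn_le_norm vK)); rewrite exprMn.
apply: ler_wpM2r; first exact: sqr_ge0.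
by rewrite -natrX ler_nat expnS expn1 (leq_trans (leqnSn n))// leq_pmulr.
Qed.

(** A strengthening of [trajectory] that is stable under appending a flow segment: Lipschitz instead
    of absolutely continuous, a control defined on the whole line, a finite exceptional set instead
    of a null set. *)
Definition piecewise_trajectory (R : realType) (n m : nat)
    (Y : 'I_m.+1 -> 'rV[R]_n -> 'rV[R]_n) (U : set 'rV[R]_m) (T : R)
    (x : R -> 'rV[R]_n) : Prop :=
  (exists2 L : R, 0 <= L &
    forall a b, 0 <= a -> a <= b -> b <= T -> `|x b - x a| <= L * (b - a)) /\
  exists (u : R -> 'rV[R]_m) (E : set R),
    [/\ forall i, measurable_fun setT (fun t => u t ord0 i),
        forall t, U (u t), finite_set E &
        forall t, 0 <= t <= T -> ~ E t ->
          is_derive t 1 x (ctrl_field Y (u t) (x t))].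

Section reachability.
Variables (R : realType) (n m : nat) (Y : 'I_m.+1 -> 'rV[R]_n -> 'rV[R]_n).
Variable U : set 'rV[R]_m.

Lemma piecewise_trajectoryP T x :
  piecewise_trajectory Y U T x -> trajectory Y U T x.
Proof.
move=> [[L L0 hL] [u [E [mu uU fE hE]]]]; split.
  move=> e e0; pose M := n.+1%:R * (L + 1).
  have M0 : 0 < M by rewrite mulr_gt0// ltr_wpDl.
  exists (e / M); first by rewrite divr_gt0.
  move=> k a b hab _ sd.
  apply: (@le_lt_trans _ _ (M * \sum_i (b i - a i))); last first.
    by rewrite mulrC -ltr_pdivlMr.
  rewrite mulr_sumr; apply: ler_sum => i _; have [a0 [ab bT]] := hab i.
  rewrite /M -mulrA; apply: enorm_le; apply: (le_trans (hL _ _ a0 ab bT)).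
  by apply: ler_wpM2r; rewrite ?subr_ge0// lerDl.
exists u; split=> [i|t _|]; [exact: measurable_funTS|exact: uU|].
have : (@lebesgue_measure R).-negligible E.
  have mE : measurable E.
    apply: countable_measurable; last exact: finite_set_countable.
    by move=> t; exact: measurable_set1.
  apply/negligibleP => //; apply: countable_lebesgue_measure0.
  exact: finite_set_countable.
apply: negligibleS => t /=; apply: contra_notP => Et.
by rewrite in_itv/= => tT; exact: hE.
Qed.

Lemma is_derive_translate (h : R -> 'rV[R]_n) (t T : R) v :
  is_derive (t - T) 1 h v -> is_derive t 1 (fun r => h (r - T)) v.
Proof.
have E : (fun k : R => k^-1 *: (((fun r => h (r - T)) \o shift t) (k *: (1 : R))
    - h (t - T))) =
   (fun k : R => k^-1 *: ((h \o shift (t - T)) (k *: (1 : R)) - h (t - T))).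
  by apply/funext => k; rewrite /= addrA.
move=> [dh hv]; apply: DeriveDef; first by rewrite /derivable E.
by rewrite /derive E.
Qed.

Lemma piecewise_trajectory_flow T x s w :
  (forall i, analytic_field (Y i)) -> standing_assumption Y U ->
  0 <= T -> 0 <= s -> U w -> piecewise_trajectory Y U T x ->
  exists x', [/\ piecewise_trajectory Y U (T + s) x', x' 0 = x 0 &
    x' (T + s) = flow (ctrl_field Y w) s (x T)].
Proof.
move=> anY [cY UE] T0 s0 Uw [[L L0 hL] [u [E [mu uU fE hE]]]].
have cW := ctrl_complete cY Uw.
have lW : locally_lipschitz (ctrl_field Y w).
  by apply: ctrl_locally_lipschitz => //; rewrite -UE.
have [h [h0 ih hs]] := flowP (x T) cW s0.
have ch := integral_curve_cont ih.
have [rho rho0 hrho] := curve_bounded ch.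
have [L' L'0 hL'] := locally_lipschitz_ball lW rho.
(* A bound on the speed along [h], by comparing the field at [h r] with its value at 0. *)
pose K := L' * rho + `|ctrl_field Y w 0|.
have K0 : 0 <= K by rewrite addr_ge0// mulr_ge0.
have hK r : 0 <= r <= s -> `|ctrl_field Y w (h r)| <= K.
  move=> rs; have hr := hrho _ rs.
  rewrite -[ctrl_field Y w (h r)](subrK (ctrl_field Y w 0)).
  apply: (le_trans (ler_normD _ _)); rewrite /K lerD2r.
  have := hL' (h r) 0 hr; rewrite normr0 subr0 => /(_ rho0) h1.
  by apply: (le_trans h1); exact: ler_wpM2l.
have hlip a b : 0 <= a -> a <= b -> b <= s -> `|h b - h a| <= K * (b - a).
  move=> a0 ab bs; apply: (@curve_increment _ _ _ (ctrl_field Y w \o h)) => //.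
    by apply: continuous_subspaceW ch; apply: subset_itvScc; rewrite bnd_simp.
  move=> r /andP[ar rb]; split; last first.
    by apply: hK; rewrite (le_trans a0 (ltW ar)) (le_trans (ltW rb)).
  apply: integral_curve_derive ih _.
  by rewrite (le_lt_trans a0 ar) (lt_le_trans rb).
pose x' t := if t <= T then x t else h (t - T).
have x'T t : T <= t -> x' t = h (t - T).
  rewrite /x'; have [tT Tt|//] := leP t T.
  have -> : t = T by apply/eqP; rewrite eq_le tT.
  by rewrite subrr h0.
exists x'; split; last 2 first.
- by rewrite /x' T0.
- by rewrite x'T ?lerDl// addrAC subrr add0r.
split.
  exists (L + K); first exact: addr_ge0.
  move=> a b a0 ab bT.
  have le1 c d : c <= d -> L * (d - c) <= (L + K) * (d - c).
    by move=> cd; apply: ler_wpM2r; rewrite ?subr_ge0// lerDl.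
  have le2 c d : c <= d -> K * (d - c) <= (L + K) * (d - c).
    by move=> cd; apply: ler_wpM2r; rewrite ?subr_ge0// lerDr.
  have hr c d : T <= c -> c <= d -> d <= T + s ->
      `|x' d - x' c| <= (L + K) * (d - c).
    move=> Tc cd dT; rewrite !x'T//; last exact: le_trans cd.
    apply: le_trans (le2 _ _ cd).
    have -> : d - c = (d - T) - (c - T) by ring.
    by apply: hlip; rewrite ?subr_ge0 ?lerD2r// lerBlDl.
  have hl c d : 0 <= c -> c <= d -> d <= T ->
      `|x' d - x' c| <= (L + K) * (d - c).
    move=> c0 cd dT; rewrite /x' dT (le_trans cd dT).
    by apply: le_trans (le1 _ _ cd); exact: hL.
  have [bT'|Tb] := leP b T; first exact: hl.
  have [aT|Ta] := leP a T; last by apply: hr => //; exact: ltW.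
  have -> : x' b - x' a = (x' b - x' T) + (x' T - x' a) by rewrite addrA subrK.
  apply: (le_trans (ler_normD _ _)).
  have -> : (L + K) * (b - a) = (L + K) * (b - T) + (L + K) * (T - a) by ring.
  by apply: lerD; [apply: hr => //; exact: ltW|exact: hl].
(* The one-sided derivatives may differ at [T], and beyond [T + s] nothing is known about [h], so
   both times become exceptional. *)
exists (fun t => if T < t then w else u t), (E `|` [set T; T + s]); split.
- move=> i.
  have -> : (fun t => (if T < t then w else u t) ord0 i) =
      (fun t => if T < t then w ord0 i else u t ord0 i).
    by apply/funext => t; case: ifP.
  apply: measurable_fun_ifT => //.
  apply: measurable_realfun.measurable_fun_ltr; first exact: measurable_cst.
  exact: measurable_id.
- by move=> t; case: ifP.
- by rewrite finite_setU; split => //; rewrite finite_setU; split;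
    exact: finite_set1.
move=> t /andP[t0 tTs] /not_orP[nE /not_orP[/eqP tT /eqP tTS]].
have [tleT|Tt] := leP t T.
  have {}tT : t < T by rewrite lt_neqAle tT.
  have -> : x' t = x t by rewrite /x' tleT.
  apply: (@near_eq_is_derive _ _ _ x); last by apply: hE => //; rewrite t0.
  have : nbhs t [set r | r < T] by exact: lt_nbhsl.
  by apply: filterS => r /= rT; rewrite /x' ltW.
have -> : x' t = h (t - T) by rewrite x'T// ltW.
apply: (@near_eq_is_derive _ _ _ (fun r => h (r - T))).
  have : nbhs t [set r | T < r] by exact: lt_nbhsr.
  by apply: filterS => r /= rT; rewrite x'T// ltW.
apply: is_derive_translate; apply: integral_curve_derive ih _.
by rewrite subr_gt0 Tt/= ltrBlDl lt_neqAle tTS.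
Qed.

Lemma flow_comp_reachable p x0 (w : 'I_p -> 'rV[R]_m) (tau : 'rV[R]_p) t :
  (forall i, analytic_field (Y i)) -> standing_assumption Y U -> U 0 ->
  (forall j, U (w j)) -> (forall j, 0 <= tau ord0 j) ->
  \sum_j tau ord0 j <= t -> reachable Y U t x0 (flow_comp Y x0 w tau).
Proof.
move=> anY asmY U0 wU tau0 taut.
suff [x [px x00 <-]] : exists x, [/\
    piecewise_trajectory Y U (\sum_(j <- enum 'I_p) tau ord0 j) x, x 0 = x0 &
    x (\sum_(j <- enum 'I_p) tau ord0 j) = flow_comp Y x0 w tau].
  exists (\sum_(j <- enum 'I_p) tau ord0 j), x; split=> //.
    by rewrite sumr_ge0//= big_enum.
  exact: piecewise_trajectoryP.
(* The fold applies the last entry first, so the head of the list is the segment appended at the end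
   in time. *)
rewrite /flow_comp; elim: (enum 'I_p) => [|j s [x [px x00 xs]]] /=.
  exists (cst x0); split=> //; rewrite big_nil; split.
    by exists 0 => // a b _ _ _; rewrite subrr normr0 mul0r.
  (* The time interval is reduced to 0, which is declared exceptional. *)
  exists (cst 0), [set 0]; split=> //.
  by move=> t' t0 nE; exfalso; apply: nE; apply/eqP; rewrite eq_le andbC.
have [|x' [px' x'0 x's]] :=
  piecewise_trajectory_flow anY asmY _ (tau0 j) (wU j) px.
  exact: sumr_ge0.
exists x'; split; rewrite ?x'0// big_cons addrC//.
by rewrite x's xs.
Qed.

End reachability.

(** * Elimination of the blocks run for time 0 *)

Lemma foldr_filter_id (T S : Type) (f : T -> S -> S) (a : pred T) y s :
  (forall k z, ~~ a k -> f k z = z) ->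
  foldr f y s = foldr f y [seq k <- s | a k].
Proof.
move=> fa; elim: s => [//|k s ih] /=.
by case: ifPn => ak /=; [rewrite ih|rewrite fa].
Qed.

(** Equality as sequences is needed, since flows do not commute: both sides are strictly increasing
    and have the same elements. *)
Lemma filter_sig1_enum (r : nat) (p : 'I_r -> nat) (i : 'I_r) :
  [seq k <- enum 'I_(\sum_i p i)%N | tagnat.sig1 k == i] =
  map (tagnat.Rank i) (enum 'I_(p i)).
Proof.
have enum_sorted q : sorted (fun a b : 'I_q => (a < b)%N) (enum 'I_q).
  have := iota_ltn_sorted 0 q.
  by rewrite -val_enum_ord sorted_map.
apply: (@irr_sorted_eq _ (fun a b : 'I_(\sum_i p i)%N => (a < b)%N)).
- by move=> a b c; exact: ltn_trans.
- by move=> a; exact: ltnn.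
- by apply: sorted_filter (enum_sorted _) => a b c; exact: ltn_trans.
- rewrite sorted_map; apply: sub_sorted (enum_sorted (p i)) => a b ab /=.
  exact: (etrans (@tagnat.lt_Rank _ p i a b) ab).
move=> k; rewrite mem_filter mem_enum andbT; apply/eqP/mapP.
  by move=> <-; exists (tagnat.sig2 k); rewrite ?mem_enum// tagnat.sig2K.
by move=> [l _ ->]; exact: tagnat.Rank1K.
Qed.

(** Outside block [i] the flows run for time 0 and are identities; inside it the controls are those
    chosen for [x_i], in the same order. *)
Lemma flow_comp_block (R : realType) (n m : nat)
    (Y : 'I_m.+1 -> 'rV[R]_n -> 'rV[R]_n) x0 (c : perturbation_choice R n m) i
    (v : 'rV[R]_(pc_p c i)) :
  flow_comp Y x0 (pc_u c) (block_embed c i v) =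
  flow_comp Y x0 (lc_w (pc_at c i)) v.
Proof.
rewrite /flow_comp (@foldr_filter_id _ _ _ (fun k => tagnat.sig1 k == i)).
  rewrite filter_sig1_enum foldr_map; congr foldr.
  apply/funext => l; apply/funext => y; rewrite mxE.
  rewrite (big_pred1 l) => [|l']; last first.
    by rewrite /= -val_eqE /= tagnat.eq_Rank eqxx.
  congr (flow (ctrl_field Y _) _ _).
  by rewrite /pc_u /tagnat.sig1 /tagnat.sig2 tagnat.rankK.
move=> k z ki; rewrite mxE.
rewrite [X in flow _ X](_ : _ = 0) ?flow0//; apply: big_pred0 => l.
by apply: contraNF ki => /eqP <-; rewrite tagnat.Rank1K.
Qed.

(** * Comparison of the two systems *)

(** The speed bound [K] is available only inside the ball of radius [r], and the curve remains
    inside because of that bound: again a case for [continuity_trap]. The number [q] stands for the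
    time already elapsed, so that the estimate chains along segments. *)
Lemma curve_stays_near (R : realType) (n : nat) (W : 'rV[R]_n -> 'rV[R]_n) x0 g
    (r K q s : R) : 0 < r -> 0 <= K -> 0 <= s ->
  (forall u, `|u| <= r -> `|W (x0 + u)| <= K) ->
  integral_curve set0 (fun=> W) s g ->
  `|g 0 - x0| <= K * q -> K * (q + s) < r ->
  forall p, 0 <= p <= s -> `|g p - x0| <= K * (q + p).
Proof.
move=> r0 K0 s0 hW ig g0 Kr.
have step p : 0 <= p <= s -> (forall p', 0 <= p' < p -> `|g p' - x0| < r) ->
    `|g p - x0| <= K * (q + p).
  move=> /andP[p0 ps] hp.
  have ip := integral_curve_restrict ps ig.
  have : `|g p - g 0| <= K * (p - 0).
    apply: (@curve_increment _ _ _ (W \o g)) => //.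
      exact: integral_curve_cont ip.
    move=> p' pp'; split; first exact: integral_curve_derive ip pp'.
    have /andP[p'0 p'p] := pp'.
    rewrite /= -[g p'](subrKC x0); apply: hW; apply/ltW/hp.
    by rewrite (ltW p'0).
  rewrite subr0 => h1; rewrite -[g p](subrK (g 0)) -addrA mulrDr addrC.
  by apply: (le_trans (ler_normD _ _)); exact: lerD.
move=> p ps; apply: (step) => // p' /andP[p'0 p'p].
have p's : 0 <= p' <= s.
  by case/andP : ps => _ ps; rewrite p'0 (le_trans (ltW p'p)).
pose f p := r^-1 * `|g p - x0|.
suff : f p' < 1 by rewrite /f mulrC ltr_pdivrMr// mul1r.
apply: (@continuity_trap _ f s) => //.
  move=> z; apply: (@continuousM _ _ (cst r^-1 : subspace `[0, s] -> R)
    (fun z : subspace `[0, s] => `|g z - x0|)).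
    by apply: continuous_subspaceT => ?; exact: cst_continuous.
  apply: (@continuous_comp _ _ _
    (fun z : subspace `[0, s] => g z - x0) (fun v : 'rV[R]_n => `|v|)).
    apply: continuousB; first exact: (integral_curve_cont ig).
    exact: cst_continuous.
  exact: norm_continuous.
move=> z zs hz; rewrite /f mulrC ltr_pdivrMr// mul1r.
apply: (le_lt_trans (step z zs _)).
  by move=> z' /hz; rewrite /f mulrC ltr_pdivrMr// mul1r.
apply: le_lt_trans Kr; apply: ler_wpM2l => //.
by rewrite lerD2l; case/andP : zs.
Qed.

(* Agreement of the Taylor polynomials to order N gives an error D of order
   t ^ N.+1 along the curves, which absorbs the loss in curve_gronwall. *)
Lemma flow_comp_close (R : realType) (n m N : nat)
    (X Y : 'I_m.+1 -> 'rV[R]_n -> 'rV[R]_n) (U : set 'rV[R]_m) x0 :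
  (forall i, analytic_field (X i)) -> (forall i, analytic_field (Y i)) ->
  standing_assumption X U -> standing_assumption Y U ->
  (forall i, same_taylor N x0 (X i) (Y i)) ->
  exists t1 M : R, [/\ 0 < t1, 0 < M & forall t, 0 < t <= t1 ->
    forall p (w : 'I_p -> 'rV[R]_m) (tau : 'rV[R]_p), (forall j, U (w j)) ->
    (forall j, 0 <= tau ord0 j) -> \sum_j tau ord0 j <= t ->
    enorm (flow_comp Y x0 w tau - flow_comp X x0 w tau) <= M * t ^+ N.+1].
Proof.
move=> anX anY [cX UE] [cY _] XY.
have [rX [KX [rX0 KX0 hKX]]] := ctrl_bounded anX x0.
have [rY [KY [rY0 KY0 hKY]]] := ctrl_bounded anY x0.
have [rL [L [rL0 L0 hL]]] := ctrl_lipschitz anY x0.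
have [rF [F [rF0 F0 hF]]] := ctrl_flat anX anY XY.
pose r := Num.min (Num.min rX rY) (Num.min rL rF).
have r0 : 0 < r by rewrite !lt_min rX0 rY0 rL0.
have [rXle rYle rLle rFle] : [/\ r <= rX, r <= rY, r <= rL & r <= rF].
  by rewrite /r; split; rewrite !ge_min lexx ?orbT.
(* A common speed bound for both systems; the 1 makes it positive. *)
pose K := KX + KY + 1.
have K0 : 0 < K by rewrite /K; lra.
pose a := 1 + 2 * n%:R * L ^+ 2.
have a0 : 0 <= a by rewrite addr_ge0// !mulr_ge0// sqr_ge0.
(* [M * t ^+ N.+1] is the square root of [2 n D^2 e^a], the Gronwall bound at elapsed time 1, for
   [D = F (K t)^(N+1)]. *)
pose M := Num.sqrt (2 * n%:R * expR a) * (F * K ^+ N.+1).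
have M0 : 0 <= M by rewrite !mulr_ge0// ?exprn_ge0// ?sqrtr_ge0// ltW.
(* [t <= 1] bounds the elapsed time in the Gronwall factor by 1; [t <= r / (2 K)] gives [K t < r],
   so both curves stay where all four local estimates hold. [M + 1] is positive even if [M = 0]. *)
exists (Num.min 1 (r / (2 * K))), (M + 1); split.
- by rewrite lt_min ltr01 divr_gt0// mulr_gt0.
- by rewrite ltr_wpDl.
move=> t /andP[t0]; rewrite le_min => /andP[t1 tr] p w tau wU tau0 taut.
have Ktr : K * t < r.
  by move: tr; rewrite ler_pdivlMr ?mulr_gt0// => tr; nra.
pose D := F * (K * t) ^+ N.+1.
have D0 : 0 <= D by rewrite mulr_ge0// exprn_ge0// mulr_ge0// ltW.
have : \sum_(j <- enum 'I_p) tau ord0 j <= t by rewrite big_enum.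
(* The invariant involves the elapsed time [q] only. A segment of length [l] preserves it, because
   with [c = 2 n D^2] one has [(c q e^(a q) + c l) e^(a l) <= c (q + l) e^(a (q + l))]. *)
have main s : \sum_(j <- s) tau ord0 j <= t ->
  let q := \sum_(j <- s) tau ord0 j in
  let A := foldr (fun (j : 'I_p) y =>
    flow (ctrl_field X (w j)) (tau ord0 j) y) x0 s in
  let B := foldr (fun (j : 'I_p) y =>
    flow (ctrl_field Y (w j)) (tau ord0 j) y) x0 s in
  [/\ `|A - x0| <= K * q, `|B - x0| <= K * q &
      sqn (A - B) <= 2 * n%:R * D ^+ 2 * q * expR (a * q)].
  elim: s => [_|j s ih] /=.
    by rewrite big_nil !subrr normr0 sqn0 !mulr0 mul0r.
  rewrite big_cons; set q := \sum_(_ <- s) _ in ih *.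
  set A := foldr _ _ _ in ih *; set B := foldr _ _ _ in ih *.
  set l := tau ord0 j => lqt.
  have l0 : 0 <= l by exact: tau0.
  have q0 : 0 <= q by exact: sumr_ge0.
  have [|hA hB hAB] := ih; first by apply: le_trans lqt; rewrite lerDr.
  have wj : unit_cube (w j) by rewrite -UE.
  have [g [g0 ig gl]] := flowP A (ctrl_complete cX (wU j)) l0.
  have [h [h0 ih' hl]] := flowP B (ctrl_complete cY (wU j)) l0.
  have qlr : K * (q + l) < r.
    by apply: le_lt_trans Ktr; apply: ler_wpM2l; [exact: ltW|rewrite addrC].
  have gn p' : 0 <= p' <= l -> `|g p' - x0| <= K * (q + p').
    apply: (curve_stays_near r0 (ltW K0) l0 _ ig) => //; last by rewrite g0.
    move=> u ur; apply: (@le_trans _ _ KX); last by rewrite /K; lra.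
    by apply: hKX => //; exact: le_trans ur rXle.
  have hn p' : 0 <= p' <= l -> `|h p' - x0| <= K * (q + p').
    apply: (curve_stays_near r0 (ltW K0) l0 _ ih') => //; last by rewrite h0.
    move=> u ur; apply: (@le_trans _ _ KY); last by rewrite /K; lra.
    by apply: hKY => //; exact: le_trans ur rYle.
  rewrite -gl -hl [l + q]addrC; split.
  - by apply: gn; rewrite l0 lexx.
  - by apply: hn; rewrite l0 lexx.
  have := @curve_gronwall R n g h (ctrl_field X (w j) \o g)
    (ctrl_field Y (w j) \o h) l L D l0 L0 D0 (integral_curve_cont ig)
    (integral_curve_cont ih').
  rewrite -/a g0 h0 => hle; apply: (le_trans (hle _)).
    move=> p' pl; split; [exact: integral_curve_derive ig pl|
      exact: integral_curve_derive ih' pl|].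
    have p'l : 0 <= p' <= l by case/andP : pl => /ltW -> /ltW.
    have bnd : K * (q + p') <= K * t.
      apply: ler_wpM2l; first exact: ltW.
      by apply: le_trans lqt; rewrite addrC lerD2r; case/andP : p'l.
    have gt : `|g p' - x0| <= K * t by exact: le_trans (gn _ p'l) bnd.
    have ht : `|h p' - x0| <= K * t by exact: le_trans (hn _ p'l) bnd.
    have gr : `|g p' - x0| <= r by exact: le_trans gt (ltW Ktr).
    have hr : `|h p' - x0| <= r by exact: le_trans ht (ltW Ktr).
    have f1 := hF _ _ wj (le_trans gr rFle).
    have f2 := hL _ _ _ wj (le_trans gr rLle) (le_trans hr rLle).
    rewrite !subrKC in f1 f2; rewrite opprB addrA subrK in f2.
    (* [Y] at the point of the [X]-curve is inserted: Taylor agreement bounds [X - Y] there, and the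
       Lipschitz estimate for [Y] compares the two curves. *)
    rewrite /= -(subrK (ctrl_field Y (w j) (g p')) (ctrl_field X _ _)) -addrA.
    apply: (le_trans (ler_normD _ _)); rewrite [leRHS]addrC; apply: lerD => //.
    apply: (le_trans f1); apply: ler_wpM2l => //.
    by rewrite lerXn2r// nnegrE// mulr_ge0// ltW.
  rewrite [a * (q + l)]mulrDr expRD.
  set c := 2 * n%:R * D ^+ 2.
  have c0 : 0 <= c by apply: mulr_ge0 (sqr_ge0 D); rewrite mulr_ge0.
  rewrite [leRHS]mulrA; apply: ler_wpM2r; first exact: expR_ge0.
  have e1 : 1 <= expR (a * q) by rewrite -expR0 ler_expR mulr_ge0.
  rewrite [c * (q + l)]mulrDr mulrDl; apply: lerD => //.
  by rewrite ler_peMr// mulr_ge0.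
move=> /main[_ _]; rewrite big_enum /=.
set q := \sum_(_ in _) _; rewrite -/(flow_comp X x0 w tau).
rewrite -/(flow_comp Y x0 w tau) => hle.
have qt : q <= t by [].
have q0 : 0 <= q by exact: sumr_ge0.
apply: (@le_trans _ _ (M * t ^+ N.+1)); last first.
  by apply: ler_wpM2r; rewrite ?lerDl// exprn_ge0// ltW.
have Mt0 : 0 <= M * t ^+ N.+1 by apply: mulr_ge0 => //; rewrite exprn_ge0// ltW.
rewrite -(ger0_norm Mt0) -sqrtr_sqr ler_wsqrtr//.
have -> : \sum_i (flow_comp Y x0 w tau - flow_comp X x0 w tau) ord0 i ^+ 2 =
    sqn (flow_comp X x0 w tau - flow_comp Y x0 w tau).
  by apply: eq_bigr => i _; rewrite !mxE -sqrrN opprB.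
apply: (le_trans hle).
have -> : (M * t ^+ N.+1) ^+ 2 = 2 * n%:R * D ^+ 2 * 1 * expR (a * 1).
  rewrite /M /D !exprMn sqr_sqrtr; last by rewrite !mulr_ge0// expR_ge0.
  by rewrite !mulr1; ring.
have c0 : 0 <= 2 * n%:R * D ^+ 2.
  by apply: mulr_ge0 (sqr_ge0 D); rewrite mulr_ge0.
have q1 : q <= 1 by exact: le_trans t1.
apply: ler_pM; [exact: mulr_ge0|exact: expR_ge0|exact: ler_wpM2l|].
by rewrite ler_expR ler_wpM2l.
Qed.

(** * The perturbation mapping *)

Section local_sections.
Variables (R : realType) (n m : nat).
Variables (X : 'I_m.+1 -> 'rV[R]_n -> 'rV[R]_n) (U : set 'rV[R]_m).
Variables (x0 : 'rV[R]_n) (t : R) (c : local_choice R m).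
Hypothesis step1 : exists x, admissible_step1 X U x0 t x c.
Hypothesis step2 : admissible_step2 X x0 c.

Lemma lc_M_times tau : lc_M c tau -> (forall j, 0 < tau ord0 j) /\
  \sum_j tau ord0 j <= t.
Proof.
have [x [_ _ _ hV _]] := step1; have [[_ MV] _ _ _ _] := step2.
by move=> /MV/hV.
Qed.

Lemma lc_xi_continuous tau : lc_M c tau ->
  {for tau, continuous (lc_xi X x0 c)}.
Proof.
have [x [_ _ _ _ [_ C1 _]]] := step1; have [[_ MV] _ _ _ _] := step2.
by move=> /MV/C1[d _]; exact: differentiable_continuous.
Qed.

(** The closure of [S] stays in [M], where times are positive with total at most [t]; it is
    therefore compact, and so is its image. *)
Lemma lc_xi_closure_closed : closed (lc_xi X x0 c @` closure (lc_S c)).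
Proof.
have [_ _ _ _ clM] := step2.
apply: compact_closed; first exact: norm_hausdorff.
apply: continuous_compact.
  apply: continuous_in_subspaceT => tau /set_mem /clM.
  exact: lc_xi_continuous.
apply: bounded_closed_compact; last exact: closed_closure.
exists t; split; first exact: num_real.
move=> M tM tau /clM/lc_M_times[tau0 taut].
have M0 : 0 <= M.
  apply: ltW; apply: le_lt_trans tM; apply: le_trans taut.
  by apply: sumr_ge0 => j _; exact: ltW.
apply: norm_row_le => // j; rewrite gtr0_norm//.
apply: le_trans (ltW tM); apply: le_trans taut.
rewrite (bigD1 j)//= lerDl; apply: sumr_ge0 => i _; exact: ltW.
Qed.

Lemma lc_section : exists g : 'rV[R]_n -> 'rV[R]_(lc_p c),
  [/\ open (lc_xi X x0 c @` lc_M c),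
      forall y, (lc_xi X x0 c @` lc_M c) y -> {for y, continuous g} &
      forall a, lc_M c a -> g (lc_xi X x0 c a) = a].
Proof.
have [_ _ [oM [g [C1 gK]]] _ _] := step2.
exists g; split=> // y /C1[d _]; exact: differentiable_continuous.
Qed.

(** [S] is only relatively open in [M]. The continuous section [g] on the open set [xi(M)] turns
    membership of [g y] in the ambient open set [Q] into an open condition on [y]. *)
Lemma lc_xi_S_nbhs y : (lc_xi X x0 c @` lc_S c) y ->
  nbhs y (lc_xi X x0 c @` lc_S c).
Proof.
have [g [oM cg gK]] := lc_section.
have [_ _ _ [[Q oQ SE] _] _] := step2.
rewrite SE => -[a [Qa Ma] ay].
have xiMy : (lc_xi X x0 c @` lc_M c) y by exists a.
have n1 : nbhs y (lc_xi X x0 c @` lc_M c) by exact: open_nbhs_nbhs.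
have n2 : nbhs y (g @^-1` Q).
  apply: (cg _ xiMy); apply: open_nbhs_nbhs; split=> //.
  by rewrite -ay gK.
apply: (@filterS _ _ (nbhs_filter y) _ _ _
  (@filterI _ _ (nbhs_filter y) _ _ n1 n2)) => z [[b Mb bz] /= Qgz].
by exists b => //; split=> //; rewrite -(gK b)// bz.
Qed.

End local_sections.

Section perturbation_maps.
Variables (R : realType) (n m : nat).
Variables (X Y : 'I_m.+1 -> 'rV[R]_n -> 'rV[R]_n) (U : set 'rV[R]_m).
Variables (x0 : 'rV[R]_n) (N : nat) (C t : R) (c : perturbation_choice R n m).
Hypothesis admc : admissible X U x0 N C t c.

Lemma pc_step1 i : exists x, admissible_step1 X U x0 t x (pc_at c i).
Proof.
have [steps Bx _] := admc.
by exists (pc_x c i); have [] := steps _ (Bx i).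
Qed.

Lemma pc_step2 i : admissible_step2 X x0 (pc_at c i).
Proof. by have [steps Bx _] := admc; have [] := steps _ (Bx i). Qed.

Lemma perturbation_mapP x y : perturbation_map X Y x0 c x y <->
  exists i (tau : 'rV[R]_(lc_p (pc_at c i))),
    [/\ (lc_xi X x0 (pc_at c i) @` closure (lc_S (pc_at c i))) x,
        lc_M (pc_at c i) tau, lc_xi X x0 (pc_at c i) tau = x &
        y = flow_comp Y x0 (lc_w (pc_at c i)) tau].
Proof.
split=> [[_ [i [Kx [tau [Mtau xtau ->]]]] <-]|[i [tau [Kx Mtau xtau ->]]]].
  by exists i, tau; split=> //; exact: flow_comp_block.
exists (block_embed c i tau); last exact: flow_comp_block.
by exists i; split=> //; exists tau.
Qed.

Lemma pc_controls i j : U (lc_w (pc_at c i) j).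
Proof. by have [x []] := pc_step1 i. Qed.

Lemma perturbation_map_reachable x :
  (forall i, analytic_field (Y i)) -> standing_assumption Y U -> U 0 ->
  perturbation_map X Y x0 c x `<=` reachable Y U t x0.
Proof.
move=> anY asmY U0 y /perturbation_mapP[i [tau [_ Mtau _ ->]]].
have [tau0 taut] := lc_M_times (pc_step1 i) (pc_step2 i) Mtau.
apply: flow_comp_reachable => // [j|j]; first exact: pc_controls.
exact: ltW.
Qed.

(* Blocks whose compact set xi (closure S) misses x are irrelevant near x; every
   other block contributes one continuous section, and the first section comes
   from a block whose open set xi S contains x. *)
Lemma perturbation_map_sections x :
  (forall i, analytic_field (Y i)) -> standing_assumption Y U ->
  eball x0 (C / 2 * t ^+ N) x ->
  exists (l : nat) (W : set 'rV[R]_n) (f : 'I_l.+1 -> 'rV[R]_n -> 'rV[R]_n),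
    [/\ W `<=` eball x0 (C / 2 * t ^+ N),
        within (eball x0 (C / 2 * t ^+ N)) (nbhs x) W,
        forall i : 'I_l.+1, {within W, continuous (f i)} &
        forall y : 'rV[R]_n, W y ->
          [set f ord0 y] `<=` perturbation_map X Y x0 c y /\
          perturbation_map X Y x0 c y `<=`
            [set z | exists i : 'I_l.+1, z = f i y]].
Proof.
move=> anY asmY Bx.
pose xi i := lc_xi X x0 (pc_at c i).
pose M i := lc_M (pc_at c i); pose S i := lc_S (pc_at c i).
pose g i := sval (cid (lc_section (pc_step2 i))).
have gP i : [/\ open (xi i @` M i),
      forall y, (xi i @` M i) y -> {for y, continuous (g i)} &
      forall a, M i a -> g i (xi i a) = a].
  by rewrite /g; case: cid.
have clM i : closure (S i) `<=` M i by have [_ _ _ _ +] := pc_step2 i.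
pose K i := xi i @` closure (S i).
have KM i : K i `<=` xi i @` M i by exact: image_subset.
pose f0 i y := flow_comp Y x0 (lc_w (pc_at c i)) (g i y).
have cf0 i y : (xi i @` M i) y -> {for y, continuous (f0 i)}.
  have [_ cg gK] := gP i; move=> xMy.
  apply: continuous_comp; first exact: cg.
  apply: (flow_comp_continuous anY asmY); first exact: pc_controls.
  have [a Ma <-] := xMy; rewrite gK//.
  by have [] := lc_M_times (pc_step1 i) (pc_step2 i) Ma.
have [_ _ /(_ _ Bx)[i0 _ Sx]] := admc.
pose A i y := if `[< K i x >] then (xi i @` M i) y else ~ K i y.
pose W := [set y | [/\ eball x0 (C / 2 * t ^+ N) y, (xi i0 @` S i0) y &
  forall i, A i y]].
(* Index 0 carries the section through [S i0], which always is a value of the mapping. Irrelevant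
   blocks receive the same function as a filler. *)
pose f (k : 'I_(pc_r c).+1) : 'rV[R]_n -> 'rV[R]_n :=
  if unlift ord0 k is Some i then (if `[< K i x >] then f0 i else f0 i0)
  else f0 i0.
have SM : xi i0 @` S i0 `<=` xi i0 @` M i0.
  by apply: image_subset; apply: subset_trans (clM i0); exact: subset_closure.
exists (pc_r c), W, f; split.
- by move=> y [].
- have nA i : nbhs x (A i).
    rewrite /A; case: asboolP => Kx.
      by apply: open_nbhs_nbhs; split; [have [] := gP i|exact: KM].
    apply: open_nbhs_nbhs; split=> //; apply: closed_openC.
    exact: lc_xi_closure_closed (pc_step1 i) (pc_step2 i).
  have n1 := lc_xi_S_nbhs (pc_step2 i0) Sx.
  have n2 : nbhs x [set y | forall i, A i y].
    exact: (filter_forall (nbhs_filter x)).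
  apply: (@filterS _ _ (nbhs_filter x) _ _ _
    (@filterI _ _ (nbhs_filter x) _ _ n1 n2)) => y [Sy Ay] By.
  by split.
- move=> k; apply: continuous_in_subspaceT => y /set_mem[_ /SM My Ay].
  rewrite /f; case: unliftP => [i _|_]; last exact: cf0.
  by have := Ay i; rewrite /A; case: asboolP => Kx Aiy; exact: cf0.
move=> y [By [a Sa ay] Ay]; have [_ _ gK] := gP i0; split.
  move=> _ ->; rewrite /f unlift_none; apply/perturbation_mapP.
  have clS : closure (S i0) a by exact: subset_closure.
  have Ma : M i0 a by exact: clM.
  exists i0, a; split=> //; first by exists a.
  by rewrite /f0 -ay gK.
move=> z /perturbation_mapP[i [tau [Ky Mtau tauy ->]]].
exists (lift ord0 i); rewrite /f liftK.
have := Ay i; rewrite /A; case: asboolP => // Kx _.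
by have [_ _ gKi] := gP i; rewrite /f0 -tauy gKi.
Qed.

End perturbation_maps.

Theorem theorem6p1 (R : realType) (n m : nat)
    (X Y : 'I_m.+1 -> 'rV[R]_n -> 'rV[R]_n) (U : set 'rV[R]_m)
    (x0 : 'rV[R]_n) (N : nat) (C T : R)
    (sysX : control_affine_system X U) (sysY : control_affine_system Y U)
    (asmX : standing_assumption X U) (asmY : standing_assumption Y U)
    (eqX : equilibrium X x0)
    (C_gt0 : 0 < C) (T_gt0 : 0 < T)
    (growthX : growth_rate_with X U x0 N C T)
    (taylorXY : forall i : 'I_m.+1, same_taylor N x0 (X i) (Y i))
    (c : R -> perturbation_choice R n m)
    (admc : forall t : R, 0 < t <= T -> admissible X U x0 N C t (c t)) :
  [/\ (forall t : R, 0 < t <= T ->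
       forall x : 'rV[R]_n, eball x0 (C / 2 * t ^+ N) x ->
         perturbation_map X Y x0 (c t) x `<=` reachable Y U t x0),
      (forall t : R, 0 < t <= T ->
       forall x : 'rV[R]_n, eball x0 (C / 2 * t ^+ N) x ->
       exists (l : nat) (W : set 'rV[R]_n) (f : 'I_l.+1 -> 'rV[R]_n -> 'rV[R]_n),
         [/\ W `<=` eball x0 (C / 2 * t ^+ N),
             within (eball x0 (C / 2 * t ^+ N)) (nbhs x) W,
             forall i : 'I_l.+1, {within W, continuous (f i)} &
             forall y : 'rV[R]_n, W y ->
               [set f ord0 y] `<=` perturbation_map X Y x0 (c t) y /\
               perturbation_map X Y x0 (c t) y `<=`
                 [set z | exists i : 'I_l.+1, z = f i y]]) &
      (exists alpha Tmin : R, [/\ 0 < alpha, 0 < Tmin < T &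
       forall t : R, 0 < t <= Tmin ->
       forall x : 'rV[R]_n, eball x0 (C / 2 * t ^+ N) x ->
       forall y : 'rV[R]_n, perturbation_map X Y x0 (c t) x y ->
         enorm (y - x) <= alpha * t ^+ N.+1])].
Proof.
have [anX _] := sysX; have [anY U0] := sysY; split.
- move=> t tT x _.
  exact: (perturbation_map_reachable (admc t tT)).
- by move=> t tT x Bx; exact: (perturbation_map_sections (admc t tT)).
have [t1 [M [t10 M0 close]]] := flow_comp_close anX anY asmX asmY taylorXY.
(* [T / 2] makes [Tmin < T] strict. *)
exists M, (Num.min t1 (T / 2)); split=> //.
  rewrite lt_min t10 divr_gt0//= gt_min; apply/orP; right.
  by rewrite ltr_pdivrMr// ltr_pMr// ltr1n.
move=> t /andP[t0]; rewrite le_min => /andP[tt1 tT2] x Bx y.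
have tT : 0 < t <= T by rewrite t0 (le_trans tT2)//; lra.
move=> /perturbation_mapP[i [tau [_ Mtau <- ->]]].
have adm := admc t tT.
have [tau0 taut] := lc_M_times (pc_step1 adm i) (pc_step2 adm i) Mtau.
apply: close => //; first by rewrite t0.
  by move=> j; exact: (pc_controls adm).
by move=> j; exact: ltW.
Qed.
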